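(* Let $n\ge 1$. If $\mu$ is a discrete measure on $S^{n-1}$ that is not concentrated on any closed hemisphere of $S^{n-1}$ and satisfies the essential subspace concentration condition, then $\mu$ is the cone-volume measure of a polytope in $\mathbb{R}^n$ containing the origin in its interior; that is, there is a polytope $P\subset\mathbb{R}^n$ with the origin in its interior such that $V_P=\mu$.
   Context: $S^{n-1}$ is the unit sphere of $\mathbb{R}^n$. A discrete measure on $S^{n-1}$ is a measure $\mu=\sum_{i=1}^N\gamma_i\delta_{u_i}$ with $N$ finite, $\gamma_i\in(0,\infty)$, $u_i\in S^{n-1}$, where $\delta_u$ is the unit point mass at $u$. A polytope is the convex hull of a finite set, having positive $n$-dimensional volume. Cone-volume measure: if a polytope $P$ contains the origin in its interior and has facets with outer unit normals $v_1,\dots,v_M$, where the facet with normal $v_k$ has $(n-1)$-dimensional measure $a_k$ and distance $h_k$ from the origin, then $V_P=\frac1n\sum_{k=1}^M h_ka_k\delta_{v_k}$. (For $n=1$: $P=[a,b]$ with $a<0<b$, $V_P(\{-1\})=|a|$ and $V_P(\{1\})=b$.) For a linear subspace $\xi$ with $\dim\xi\ge1$, a closed hemisphere of $\xi\cap S^{n-1}$ is a set $\{x\in\xi\cap S^{n-1}: x\cdot v\ge0\}$ with $v\in\xi\setminus\{0\}$ (for $n=1$ the closed hemispheres of $S^0=\{-1,1\}$ are $\{1\}$ and $\{-1\}$). A measure is concentrated on a set if its complement has measure zero; a subset of the sphere is concentrated on a closed hemisphere if it is contained in it. A linear subspace $\xi$ of $\mathbb{R}^n$ with $1\le\dim\xi\le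 n-1$ is essential with respect to a Borel measure $\mu$ on $S^{n-1}$ if $\xi\cap\mathrm{supp}(\mu)$ is not concentrated on any closed hemisphere of $\xi\cap S^{n-1}$. A finite Borel measure $\mu$ on $S^{n-1}$ satisfies the essential subspace concentration condition if for every subspace $\xi$ of $\mathbb{R}^n$ with $0<\dim\xi<n$ that is essential with respect to $\mu$, $$\mu(\xi\cap S^{n-1})\le\frac{\dim\xi}{n}\,\mu(S^{n-1}),$$ and whenever equality holds for some essential subspace $\xi$, there exists a subspace $\xi'$ complementary to $\xi$ in $\mathbb{R}^n$ with $$\mu(\xi'\cap S^{n-1})=\frac{\dim\xi'}{n}\,\mu(S^{n-1}).$$ (For $n=1$ this condition is vacuous.) *)

(* Defs.v *)
From HB Require Import structures.
From mathcomp Require Import all_boot all_order all_algebra.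
From mathcomp Require Import all_classical all_reals all_analysis.

Set Implicit Arguments.
Unset Strict Implicit.
Unset Printing Implicit Defensive.

Import Order.TTheory GRing.Theory Num.Theory.
Import numFieldNormedType.Exports.

Local Open Scope classical_set_scope.
Local Open Scope ring_scope.

(* The dimension n >= 1 of the ambient space is written n.+1 throughout:
   R^n is 'rV[R]_n.+1 and R^(n-1) is 'rV[R]_n. *)

Definition dotp (R : realType) (n : nat) (u v : 'rV[R]_n) : R :=
  (u *m v^T) 0 0.

Definition unit_sphere (R : realType) (n : nat) : set 'rV[R]_n.+1 :=
  [set x | dotp x x = 1].

Lemma unit_sphere_delta (R : realType) (n : nat) :
  (delta_mx 0 0 : 'rV[R]_n.+1) \in @unit_sphere R n.
Proof.
by apply/mem_set; rewrite /unit_sphere /= /dotp trmx_delta mul_delta_mx mxE !eqxx.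
Qed.

(* The sphere as a type, with the topology induced from R^n. *)
Definition sphere (R : realType) (n : nat) : Type := set_type (@unit_sphere R n).

#[warning="-redundant-canonical-projection"]
HB.instance Definition _ (R : realType) (n : nat) :=
  Topological.copy (sphere R n) (set_type (@unit_sphere R n)).
HB.instance Definition _ (R : realType) (n : nat) :=
  isPointed.Build (sphere R n) (SigSub (unit_sphere_delta R n)).

Notation borel_sphere R n := (g_sigma_algebraType (@open (sphere R n))).

(* Lebesgue measure on R^k: the k-fold product of the Lebesgue measure of the
   line (a point mass for k = 0), by integrating the measures of the sections.
   As for product measures in the library, its value on a set that is not
   Borel is irrelevant. *)
Fixpoint lebesgue_vol (R : realType) (k : nat) : set 'rV[R]_k -> \bar R :=
  match k with
  | 0 => fun A => (\1_A (0 : 'rV[R]_0))%:E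
  | k'.+1 => fun A =>
      (\int[@lebesgue_measure R]_t
        lebesgue_vol [set y : 'rV[R]_k' | A (row_mx (t%:M : 'rV[R]_1) y)])%E
  end.

Section polytopes.
Context {R : realType} {n : nat}.
Local Notation V := 'rV[R]_n.+1.

Definition convex_hull (S : set V) : set V :=
  smallest (fun A : set V => convex_set A) S.

Definition is_polytope (P : set V) : Prop :=
  (exists2 S : set V, finite_set S & P = convex_hull S) /\
  (0 < lebesgue_vol P)%E.

Definition support_function (P : set V) (v : V) : R :=
  sup [set dotp x v | x in P].

Definition face (P : set V) (v : V) : set V :=
  [set x | P x /\ dotp x v = support_function P v].

(* v is an outer normal of a facet, i.e. the face in direction v has dimension
   n - 1: it contains n affinely independent points x and x + row i M. *)
Definition facet_normals (P : set V) : set (sphere R n) :=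
  [set v | exists (x : V) (M : 'M[R]_(n, n.+1)),
     [/\ row_free M, face P (\val v) x
       & forall i, face P (\val v) (x + row i M)]].

(* Euclidean distance from the origin to the hyperplane spanned by the facet. *)
Definition facet_distance (P : set V) (v : V) : R :=
  inf [set Num.sqrt (dotp x x)
        | x in [set x | dotp x v = support_function P v]].

Definition orthonormal_basis_perp (v : V) : set 'M[R]_(n, n.+1) :=
  [set B | B *m B^T = 1%:M /\ B *m v^T = 0].

(* (n-1)-dimensional measure of a subset F of a hyperplane orthogonal to the
   unit vector v: the Lebesgue measure of F in the coordinates x *m B^T given by
   an orthonormal basis B of the orthogonal complement of v.  Such a B exists,
   and the value does not depend on it because the Lebesgue measure is invariant
   under isometries. *)
Definition hyperplane_measure (v : V) (F : set V) : \bar R :=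
  lebesgue_vol [set x *m (xget 0 (orthonormal_basis_perp v))^T | x in F].

(* A polytope has finitely many facets, so the sum is a finite one; on any
   set with infinitely many nonzero terms it would be 0 by convention. *)
Definition cone_volume_measure (P : set V) (A : set (borel_sphere R n)) : \bar R :=
  (\sum_(v \in facet_normals P)
     (n.+1%:R^-1 * facet_distance P (\val v))%:E *
     hyperplane_measure (\val v) (face P (\val v)) * \d_(v : borel_sphere R n) A)%E.

End polytopes.

Section measures_on_sphere.
Context {R : realType} {n : nat}.
Local Notation V := 'rV[R]_n.+1.
Implicit Types (mu : {measure set (borel_sphere R n) -> \bar R})
  (xi : {vspace V}).

Definition is_discrete mu : Prop :=
  exists (N : nat) (gamma : 'I_N -> R) (u : 'I_N -> borel_sphere R n),
    (forall i, 0 < gamma i) /\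
    (forall A : set (borel_sphere R n), measurable A ->
       mu A = (\sum_(i < N) (gamma i)%:E * \d_(u i) A)%E).

Definition support mu : set (sphere R n) :=
  [set x | forall U : set (sphere R n), open U -> U x -> (0 < mu U)%E].

Definition on_subspace xi : set (sphere R n) := [set x | \val x \in xi].

Definition is_closed_hemisphere xi (H : set (sphere R n)) : Prop :=
  exists v : V, [/\ v \in xi, v != 0 &
    H = on_subspace xi `&` [set x | 0 <= dotp (\val x) v]].

Definition concentrated_on mu (A : set (sphere R n)) : Prop := mu (~` A) = 0%E.

Definition essential_subspace mu xi : Prop :=
  (0 < \dim xi < n.+1)%N /\
  ~ exists2 H, is_closed_hemisphere xi H & on_subspace xi `&` support mu `<=` H.

Definition complementary xi xi' : Prop :=
  (xi + xi' = fullv)%VS /\ (xi :&: xi' = 0)%VS.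

Definition essential_subspace_concentration mu : Prop :=
  forall xi, essential_subspace mu xi ->
    (mu (on_subspace xi) <= ((\dim xi)%:R / n.+1%:R)%:E * mu setT)%E /\
    (mu (on_subspace xi) = ((\dim xi)%:R / n.+1%:R)%:E * mu setT ->
     exists2 xi', complementary xi xi' &
       mu (on_subspace xi') = ((\dim xi')%:R / n.+1%:R)%:E * mu setT)%E.

End measures_on_sphere.

(* Main.v *)
Require Import Defs.
From HB Require Import structures.
From mathcomp Require Import all_boot all_order all_algebra.
From mathcomp Require Import all_classical all_reals all_analysis.
From mathcomp Require Import measurable_realfun ring lra.

Set Implicit Arguments.
Unset Strict Implicit.
Unset Printing Implicit Defensive.

Import Order.TTheory GRing.Theory Num.Theory.
Import numFieldNormedType.Exports.

Local Open Scope classical_set_scope.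
Local Open Scope ring_scope.

(** Write d = n.+1.  Let u_1, ..., u_N be the distinct atoms of mu, gamma_i
their masses and Gamma the total mass; for h > 0 put
P(h) = {x | x . u_i <= h_i for all i}.  The polytope is P(h) for a vector h
minimising
   [energy h = sum_i gamma_i ln h_i - (Gamma / d) ln vol P(h)]
among the critical h, those with sum_i (gamma_i / h_i) u_i = 0.  Criticality
says that the origin maximises the concave function
z |-> sum_i gamma_i ln (h_i - z . u_i), whose argument runs over the interior
of P(h); hence every h > 0 has a critical translate h_i - z . u_i
([centering]), and the problem is a min-max: the maximum over translates is
minimised over shapes.

A minimiser solves the problem.  Let h be one, let h' be h with t added to its
i-th coordinate, and let h'' be a critical translate of h'.  Since ln lies
below its tangents and h is critical, the translation contributes nothing to
the first order bound
   sum_j gamma_j ln h''_j <= sum_j gamma_j ln h_j + t gamma_i / h_i,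
while vol P(h'') = vol P(h').  Minimality then gives
   (Gamma / d) (ln vol P(h') - ln vol P(h)) <= t gamma_i / h_i
for all small t of either sign ([minimiser_variation]).  As P(h') and P(h)
differ by a slab of width |t| over the i-th facet, the area a_i of this facet
is forced to be d gamma_i vol P(h) / (Gamma h_i) ([minimiser_facet_area]).
Scaling h so that vol P(h) = Gamma makes the cone volume h_i a_i / d equal to
gamma_i; no direction is lost, because gamma_i > 0 makes every u_i a facet
normal.

A minimiser exists.  For a critical h one has |x . u_i| <= (Gamma / gamma_i) h_i
on P(h) ([critical_bound]), so vol P(h) is at most a constant times the product
of the h_i over any basis among the u_i.  Take the greedy basis for the
increasing order of the h_i.  Summation by parts bounds the energy below by
   - c - sum_k excess(I_k) (ln h_(k+1) - ln h_(k)),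
where I_k consists of the indices of the k smallest h_i and
excess(I) = gamma(I) - (Gamma / d) dim span (u_i)_(i in I)
([energy_lower_bound]).  If h_(k+1) / h_(k) is large then the u_i with i in I_k
lie in no closed hemisphere of their span ([gap_spans_positively]), and the
concentration condition gives excess(I_k) <= 0.  A large gap with negative
excess makes the energy large; a large gap with excess 0 is the equality case
of the condition, and there all other atoms lie in a complementary subspace.
The polytope then splits as a direct sum, and its two summands can be rescaled
independently without changing the energy ([rescale_balanced]), which closes
the gap.  So it suffices to minimise over vectors h with bounded ratios
h_i / h_j, a compact set up to scaling ([exists_minimiser]).

The volume is handled through the sigma-algebra generated by the coordinates,
for which it is a measure that a linear map M multiplies by |det M|
([vol_linear]); orthogonal invariance compares volumes with facet areas. *)

(** * The volume as a measure *)

(** Generating by the coordinates makes the identification of R x R^k with R^(k+1)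
measurable in both directions, and puts every polyhedron in the sigma-algebra. *)
Definition coord_sets (R : realType) (k : nat) : set (set 'rV[R]_k) :=
  [set A | exists (i : 'I_k) (B : set (measurableTypeR R)),
     measurable B /\ A = [set x : 'rV[R]_k | B (x 0 i)]].

Notation rVm R k := (g_sigma_algebraType (@coord_sets R k)).

Section coordinate_measurability.
Context {R : realType}.

Lemma measurable_coord k (i : 'I_k) :
  measurable_fun setT (fun x : rVm R k => x 0 i : measurableTypeR R).
Proof.
move=> _ B mB; rewrite setTI; apply: sub_sigma_algebra.
by exists i, B.
Qed.

Lemma measurable_fun_rV d (T : measurableType d) k (f : T -> rVm R k) :
  (forall i, measurable_fun setT (fun t => f t 0 i : measurableTypeR R)) ->
  measurable_fun setT f.
Proof.
move=> mf; apply: (@measurability _ _ _ _ setT f (@coord_sets R k)) => //.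
move=> _ [_ [i [B [mB ->]]] <-].
exact: mf.
Qed.

Lemma measurable_affine k l (A : 'M[R]_(k, l)) (b : 'rV[R]_l) :
  measurable_fun setT (fun x : rVm R k => x *m A + b : rVm R l).
Proof.
apply: measurable_fun_rV => i.
rewrite (_ : (fun _ => _) =
  (fun x : rVm R k => (\sum_j x 0 j * A j i) + b 0 i)); last first.
  by apply/funext => x; rewrite !mxE.
apply: measurable_funD; last exact: measurable_cst.
apply: measurable_sum => j.
by apply: measurable_funM; [exact: measurable_coord|exact: measurable_cst].
Qed.

Lemma measurable_preimage_affine k l (A : 'M[R]_(k, l)) (b : 'rV[R]_l)
    (S : set (rVm R l)) :
  measurable S -> measurable ([set x | S (x *m A + b)] : set (rVm R k)).
Proof. by move=> mS; rewrite -[X in measurable X]setTI; exact: measurable_affine. Qed.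

Lemma measurable_preimage_linear k l (A : 'M[R]_(k, l)) (S : set (rVm R l)) :
  measurable S -> measurable ([set x | S (x *m A)] : set (rVm R k)).
Proof.
move=> mS; have := measurable_preimage_affine A 0 mS.
by under eq_set do rewrite addr0.
Qed.

(** The identification of R x R^k with R^(k+1) that the recursive definition of
the volume uses. *)
Definition consrV k (p : measurableTypeR R * rVm R k) : rVm R k.+1 :=
  row_mx (p.1%:M : 'rV[R]_1) p.2.

Lemma measurable_consrV k : measurable_fun setT (@consrV k).
Proof.
apply: measurable_fun_rV => i.
rewrite (_ : (fun _ => _) = match fintype.split (i : 'I_(1 + k)) with
   | inl _ => fun p : measurableTypeR R * rVm R k => p.1
   | inr j => fun p => p.2 0 j end); last first.
  apply/funext => p; rewrite /consrV mxE; case: splitP => // j.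
  by rewrite !mxE (ord1 j) eqxx mulr1n.
case: fintype.split => [_|j]; first exact: measurable_fst.
exact: (measurableT_comp (measurable_coord j) measurable_snd).
Qed.

End coordinate_measurability.

Section volume_is_a_measure.
Context {R : realType}.
Local Notation leb := (@lebesgue_measure R).
Local Notation lvol k := (@lebesgue_vol R k : set (rVm R k) -> \bar R).

Definition unconsrV k (x : rVm R k.+1) : measurableTypeR R * rVm R k :=
  (x 0 0, rsubmx (x : 'rV_(1 + k))).

Lemma consrVK k : cancel (@consrV R k) (@unconsrV k).
Proof.
move=> [t y]; rewrite /unconsrV /consrV /= row_mxKr; congr (_, _).
rewrite mxE; case: fintype.splitP => // j; by rewrite !mxE (ord1 j).
Qed.

Lemma measurable_unconsrV k : measurable_fun setT (@unconsrV k).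
Proof.
apply/measurable_fun_pairP; split; first exact: measurable_coord.
apply: measurable_fun_rV => i /=.
under eq_fun do rewrite mxE.
exact: measurable_coord.
Qed.

(** Up to [consrV], the volume is the product of the length of the line with the
volume in one dimension less; this is how it inherits countable additivity and
Tonelli's theorem. *)
Lemma lebesgue_volS k (A : set 'rV[R]_k.+1) :
  lebesgue_vol A = (leb \x lvol k)%E (@consrV R k @^-1` A).
Proof.
rewrite /= /product_measure1; apply: eq_integral => t _ /=; congr lebesgue_vol.
by apply/seteqP; split=> y /=; rewrite /xsection /= ?inE.
Qed.

Let is_sfinite_measure k := [/\ lvol k set0 = 0%E, (forall A, 0 <= lvol k A)%E,
   semi_sigma_additive (lvol k) & sigma_finite setT (lvol k)].

Lemma lebesgue_vol_measureS k (sm : {sigma_finite_measure set (rVm R k) -> \bar R}) :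
  lvol k = sm -> is_sfinite_measure k.+1.
Proof.
move=> volE.
have vE A : lvol k.+1 A = (leb \x sm)%E (@consrV R k @^-1` A).
  by rewrite lebesgue_volS volE.
rewrite /is_sfinite_measure; split.
- by rewrite vE preimage_set0 measure0.
- by move=> A; rewrite vE measure_ge0.
- move=> F mF tF mUF; rewrite vE preimage_bigcup.
  under eq_fun do under eq_bigr do rewrite vE.
  apply: measure_semi_sigma_additive.
  + by move=> n; rewrite -[X in measurable X]setTI; exact: measurable_consrV.
  + apply/trivIsetP => /= i j _ _ ij; rewrite -preimage_setI.
    by move/trivIsetP : tF => /(_ _ _ _ _ ij) ->//; rewrite preimage_set0.
  + by rewrite -preimage_bigcup -[X in measurable X]setTI; exact: measurable_consrV.
- have /sigma_finiteP[F [TF ndF Foo]] := sigma_finiteT leb.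
  have /sigma_finiteP[G [TG ndG Goo]] := sigma_finiteT sm.
  exists (fun n => @unconsrV k @^-1` (F n `*` G n)).
    apply/esym; rewrite -preimage_bigcup -[RHS](preimage_setT (@unconsrV k)).
    congr (_ @^-1` _); rewrite -subTset -setXTT TF TG => -[x y].
    move=> [[i _ Fx] [j _ Gy]]; exists (maxn i j) => //; split.
    - by move: Fx; exact/subsetPset/ndF/leq_maxl.
    - by move: Gy; exact/subsetPset/ndG/leq_maxr.
  move=> n; have [? ?] := Foo n; have [? ?] := Goo n; split.
    by rewrite -[X in measurable X]setTI; apply: measurable_unconsrV => //; exact: measurableX.
  rewrite vE (_ : _ @^-1` _ = F n `*` G n).
    by rewrite product_measure1E// lte_mul_pinfty// ge0_fin_numE.
  by rewrite -comp_preimage (_ : _ \o _ = id)//; apply/funext => x; exact: consrVK.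
Qed.

Lemma lebesgue_vol_measure k : is_sfinite_measure k.
Proof.
elim: k => [|k [v0 vge0 vadd vfin]].
  rewrite /is_sfinite_measure.
  have -> : lvol 0 = dirac (0 : rVm R 0) by apply/funext => A.
  split; [exact: measure0|by move=> A; exact: measure_ge0| |exact: sigma_finiteT].
  exact: measure_semi_sigma_additive.
pose mix1 := isMeasure.Build _ _ _ (lvol k) v0 vge0 vadd.
pose m : {measure set (rVm R k) -> \bar R} := HB.pack (lvol k) mix1.
pose mix2 := Measure_isSigmaFinite.Build _ _ _ m vfin.
pose sm : {sigma_finite_measure set (rVm R k) -> \bar R} := HB.pack (lvol k) mix1 mix2.
exact: (@lebesgue_vol_measureS k sm).
Qed.

Lemma vol_set0 k : lvol k set0 = 0%E.
Proof. by have [] := lebesgue_vol_measure k. Qed.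

Lemma vol_ge0 k (A : set (rVm R k)) : (0 <= lvol k A)%E.
Proof. by have [] := lebesgue_vol_measure k. Qed.

Lemma vol_semi_sigma_additive k : semi_sigma_additive (lvol k).
Proof. by have [] := lebesgue_vol_measure k. Qed.

Lemma vol_sigma_finite k : sigma_finite setT (lvol k).
Proof. by have [] := lebesgue_vol_measure k. Qed.

(** A name on which the measure structure is declared. *)
Definition vol k : set (rVm R k) -> \bar R := @lebesgue_vol R k.
Arguments vol : clear implicits.

HB.instance Definition _ k := isMeasure.Build _ _ _ (vol k)
  (vol_set0 k) (@vol_ge0 k) (@vol_semi_sigma_additive k).

HB.instance Definition _ k := Measure_isSigmaFinite.Build _ _ _ (vol k)
  (@vol_sigma_finite k).

Lemma measurable_preimage_consrV k (A : set (rVm R k.+1)) :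
  measurable A -> measurable (@consrV R k @^-1` A).
Proof.
by move=> mA; rewrite -[X in measurable X]setTI; exact: measurable_consrV.
Qed.

Lemma vol_sections k (A : set (rVm R k.+1)) :
  vol k.+1 A = (\int[leb]_t vol k [set y | A (consrV (t, y))])%E.
Proof. by []. Qed.

(** Tonelli's theorem, slicing by lines parallel to the first axis. *)
Lemma vol_cosections k (A : set (rVm R k.+1)) : measurable A ->
  vol k.+1 A = (\int[vol k]_y leb [set t | A (consrV (t, y))])%E.
Proof.
move=> /measurable_preimage_consrV mA; rewrite [LHS]lebesgue_volS.
have := @indic_fubini_tonelli _ _ _ _ _ leb (vol k) _ mA.
rewrite indic_fubini_tonelli_FE// indic_fubini_tonelli_GE// => FE.
rewrite [LHS]FE.
apply: eq_integral => y _ /=; congr (leb _).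
by apply/seteqP; split=> t /=; rewrite /ysection /= ?inE.
Qed.

Lemma measurable_section k (A : set (rVm R k.+1)) : measurable A ->
  measurable_fun setT (fun t => vol k [set y | A (consrV (t, y))]).
Proof.
move=> /measurable_preimage_consrV mA.
have := @measurable_fun_xsection _ _ _ _ _ (vol k) _ mA.
congr measurable_fun; apply/funext => t /=; congr (vol k _).
by apply/seteqP; split=> y /=; rewrite /xsection /= ?inE.
Qed.

Lemma measurable_section_set k (A : set (rVm R k.+1)) t : measurable A ->
  measurable [set y : rVm R k | A (consrV (t, y))].
Proof.
move=> /measurable_preimage_consrV mA.
rewrite (_ : [set _ | _] = xsection (@consrV R k @^-1` A) t).
  exact: measurable_xsection.
by apply/seteqP; split=> y /=; rewrite /xsection /= ?inE.
Qed.

(** * Affine changes of variables *)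

(** Both sides are measures in B that agree on the intervals ]x, y]. *)
Lemma leb_affine (a b : R) (B : set (measurableTypeR R)) : a != 0 -> measurable B ->
  leb B = (`|a|%:E * leb [set t | B (t * a + b)%R])%E.
Proof.
move=> a0 mB.
have mf : measurable_fun setT (fun t : measurableTypeR R => t * a + b : measurableTypeR R).
  by apply: measurable_funD => //; apply: measurable_funM.
have an0 : 0 <= `|a| by [].
pose mu0 : {measure set (measurableTypeR R) -> \bar R} :=
  measure_function_pushforward__canonical__measure_function_Measure leb mf.
pose mu : {measure set (measurableTypeR R) -> \bar R} := mscale (NngNum an0) mu0.
have -> : leb B = mu B; last by [].
apply: lebesgue_measure_unique mB => _ [[x y] _ <-] /=.
rewrite /mu /= /mscale /= /mu0 /= /pushforward.
have [ap|an|a00] := ltgtP 0 a; last by rewrite a00 eqxx in a0.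
- rewrite (_ : _ @^-1` _ = `](x - b) / a, (y - b) / a]%classic); last first.
    apply/seteqP; split => t /=; rewrite !in_itv /= => /andP[h1 h2]; apply/andP; split.
    + by rewrite ltr_pdivrMr// ltrBlDr.
    + by rewrite ler_pdivlMr// lerBrDr.
    + by rewrite ltr_pdivrMr// ltrBlDr in h1.
    + by rewrite ler_pdivlMr// lerBrDr in h2.
  rewrite !lebesgue_measure_itv /= !lte_fin ltr_pM2r ?invr_gt0// ltrD2r.
  case: ifP => _; last by rewrite mule0.
  by rewrite -!EFinD -EFinM (gtr0_norm ap); congr (_%:E); field.
- rewrite (_ : _ @^-1` _ = `[(y - b) / a, (x - b) / a[%classic); last first.
    apply/seteqP; split => t /=; rewrite !in_itv /= => /andP[h1 h2]; apply/andP; split.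
    + by rewrite ler_ndivrMr// lerBrDr.
    + by rewrite ltr_ndivlMr// ltrBlDr.
    + by rewrite ltr_ndivlMr// ltrBlDr in h2.
    + by rewrite ler_ndivrMr// lerBrDr in h1.
  rewrite !lebesgue_measure_itv /= !lte_fin ltr_nM2r ?invr_lt0// ltrD2r.
  case: ifP => _; last by rewrite mule0.
  by rewrite -!EFinD -EFinM (ltr0_norm an); congr (_%:E); field.
Qed.

Lemma leb_integral_affine (a b : R) (f : measurableTypeR R -> \bar R) : a != 0 ->
  measurable_fun setT f -> (forall x, 0 <= f x)%E ->
  (\int[leb]_t f t = `|a|%:E * \int[leb]_t f (t * a + b)%R)%E.
Proof.
move=> a0 mf f0.
have mg : measurable_fun setT (fun t : measurableTypeR R => t * a + b : measurableTypeR R).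
  by apply: measurable_funD => //; apply: measurable_funM.
have an0 : 0 <= `|a| by [].
pose mu0 : {measure set (measurableTypeR R) -> \bar R} :=
  measure_function_pushforward__canonical__measure_function_Measure leb mg.
rewrite (@eq_measure_integral _ _ _ _ (mscale (NngNum an0) mu0)); last first.
  by move=> A mA _; exact: (leb_affine b a0 mA).
rewrite ge0_integral_mscale//; congr (_ * _)%E.
by rewrite ge0_integral_pushforward.
Qed.

(** The change of variables x |-> x M + b holds for products of maps for which it
holds, for block triangular matrices by slicing along the first coordinate, and
for shears of the first coordinate by slicing along the others.  Block
elimination writes every invertible matrix as such a product. *)
Let vol_affine_ok k (M : 'M[R]_k) (b : 'rV[R]_k) := forall A : set (rVm R k),
  measurable A -> vol k A = (`|\det M|%:E * vol k [set x | A (x *m M + b)%R])%E.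

Let vol_affine_ok_mul k (M N : 'M[R]_k) b :
  vol_affine_ok M 0 -> vol_affine_ok N b -> vol_affine_ok (M *m N) b.
Proof.
move=> hM hN A mA; rewrite hN// (hM [set x | A (x *m N + b)]); last first.
  exact: measurable_preimage_affine.
rewrite det_mulmx normrM EFinM muleCA muleA; congr (_ * vol k _)%E.
by apply/seteqP; split=> x /=; rewrite addr0 mulmxA.
Qed.

Let vol_affine_ok_upper k (a : R) (r : 'rV[R]_k) (C : 'M[R]_k) b : a != 0 ->
  (forall b', vol_affine_ok C b') ->
  @vol_affine_ok k.+1 (block_mx (a%:M : 'M[R]_1) r 0 C) b.
Proof.
move=> a0 hC A mA; rewrite (@det_ublock _ 1 k) det_scalar expr1 normrM EFinM.
rewrite !vol_sections (leb_integral_affine (b 0 0) a0); last 2 first.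
- exact: measurable_section.
- by move=> x; exact: measure_ge0.
rewrite -muleA; congr (_ * _)%E.
have mA' := @measurable_preimage_affine _ _ _ (block_mx (a%:M : 'M[R]_1) r 0 C) b _ mA.
rewrite -ge0_integralZl//=; last first.
  exact: (measurable_section mA').
apply: eq_integral => t _.
rewrite (hC (t *: r + rsubmx (b : 'rV_(1 + k))) _ (measurable_section_set _ mA)).
congr (_ * vol k _)%E; apply: eq_set => y; congr A.
rewrite /consrV /= (@mul_row_block _ 1 1 k 1 k) mulmx0 addr0 -[b in RHS](hsubmxK (b : 'rV_(1 + k))).
rewrite [RHS](@add_row_mx _ 1 1 k); apply: (congr2 (fun (u : 'rV[R]_1) (v : 'rV[R]_k) => row_mx u v)).
  apply/rowP => i; rewrite (ord1 i) !mxE big_ord1 !mxE eqxx !mulr1n.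
  by congr (_ + b _ _); apply/val_inj.
by rewrite mul_scalar_mx addrA [_ + y *m C]addrC.
Qed.

Let vol_affine_ok_shear k (c : 'cV[R]_k) :
  @vol_affine_ok k.+1 (block_mx (1%:M : 'M[R]_1) 0 c 1%:M) 0.
Proof.
move=> A mA; rewrite (@det_lblock _ 1 k) !det1 mulr1 normr1 mul1e.
have mA' := @measurable_preimage_affine _ _ _ (block_mx (1%:M : 'M[R]_1) 0 c 1%:M) 0 _ mA.
rewrite !vol_cosections//; apply: eq_integral => y _ /=.
rewrite (leb_affine ((y *m c) 0 0) (oner_neq0 _)); last first.
  have := measurable_ysection y (measurable_preimage_consrV mA).
  by congr measurable; apply/seteqP; split=> t /=; rewrite /ysection /= ?inE.
rewrite normr1 mul1e; congr (leb _); apply: eq_set => t; congr A.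
rewrite addr0 /consrV /= (@mul_row_block _ 1 1 k 1 k) mulmx0 add0r !mulmx1 mulr1.
apply: (congr2 (fun (u : 'rV[R]_1) (v : 'rV[R]_k) => row_mx u v)) => //.
by apply/rowP => i; rewrite (ord1 i) !mxE eqxx !mulr1n.
Qed.

Lemma vol_affine k (M : 'M[R]_k) (b : 'rV[R]_k) (A : set (rVm R k)) :
  M \in unitmx -> measurable A ->
  vol k A = (`|\det M|%:E * vol k [set x | A (x *m M + b)%R])%E.
Proof.
elim: k M b A => [|k IH] M b A uM mA.
  rewrite det_mx00 normr1 mul1e; congr (vol 0 _).
  by apply/seteqP; split=> x /=; rewrite [_ + b]thinmx0 [x]thinmx0.
have ok1 b' : @vol_affine_ok k 1%:M b' by move=> ? ?; apply: IH; rewrite ?unitmx1.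
(* A nonzero corner entry allows a block elimination. *)
have okM (a : R) (r : 'rV[R]_k) (c : 'cV[R]_k) (D : 'M[R]_k) : a != 0 ->
    (block_mx (a%:M : 'M[R]_1) r c D : 'M[R]_(1 + k)) \in unitmx ->
    @vol_affine_ok k.+1 (block_mx (a%:M : 'M[R]_1) r c D) b.
  move=> a0; pose C := D - a^-1 *: (c *m r).
  have -> : block_mx (a%:M : 'M[R]_1) r c D =
      (block_mx (1%:M : 'M[R]_1) 0 (a^-1 *: c) 1%:M : 'M[R]_(1 + k)) *m
      block_mx (a%:M : 'M[R]_1) r 0 C.
    rewrite mulmx_block !mul1mx !mul0mx !addr0 -!scalemxAl.
    rewrite mul_mx_scalar scalerA mulVf// scale1r; congr block_mx.
    by rewrite /C addrC subrK.
  rewrite unitmxE det_mulmx (@det_lblock _ 1 k) (@det_ublock _ 1 k) !det1 !mul1r.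
  rewrite unitrM => /andP[_ uC].
  apply: vol_affine_ok_mul; first exact: vol_affine_ok_shear.
  by apply: vol_affine_ok_upper => // b' B mB; apply: IH.
have M00E : ulsubmx (M : 'M[R]_(1 + k)) = (M 0 0)%:M.
  apply/matrixP => i j; rewrite !mxE (ord1 i) (ord1 j) eqxx mulr1n.
  by congr (M _ _); apply/val_inj.
move: uM mA; rewrite -[M](@submxK _ 1 k 1 k) M00E.
move: (M 0 0) (ursubmx _) (dlsubmx _) (drsubmx _) => a r c D {M M00E}.
have [-> |a0 uM] := eqVneq a 0; last exact: okM.
have [-> |c0 uM] := eqVneq c 0.
  by rewrite unitmxE (@det_ublock _ 1 k) det_scalar expr1 mul0r unitr0.
have [i ci] : exists i, c i 0 != 0.
  apply: contrapT => /forallNP cz; move/eqP: c0; apply; apply/colP => i.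
  by move/negP/negPn/eqP : (cz i) => ->; rewrite mxE.
(* Otherwise adding a later row to the first one produces such an entry. *)
pose U x : 'M[R]_(1 + k) := block_mx (1%:M : 'M[R]_1) (x *: delta_mx 0 i) 0 1%:M.
have UU : U (-1) *m U 1 = 1%:M.
  rewrite /U mulmx_block !mulmx1 !mul1mx !mulmx0 !mul0mx !addr0 !add0r scale1r.
  by rewrite scaleN1r subrr -scalar_mx_block.
have dU : \det (U 1) = 1 by rewrite (@det_ublock _ 1 k) !det1 mulr1.
rewrite -[block_mx _ _ _ _]mul1mx -UU -mulmxA.
apply: vol_affine_ok_mul => //; first exact: vol_affine_ok_upper (oner_neq0 _) ok1.
have E : U 1 *m block_mx 0%:M r c D =
    block_mx ((c i 0)%:M : 'M[R]_1) (r + row i D) c D.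
  rewrite [LHS]mulmx_block !mul1mx scale1r !mul0mx !add0r -!rowE; congr block_mx.
  by apply/matrixP => j l; rewrite !mxE (ord1 j) (ord1 l) !eqxx mulr1n add0r.
by rewrite E; apply: okM; rewrite // -E unitmxE det_mulmx dU mul1r -unitmxE.
Qed.

Lemma vol_linear k (M : 'M[R]_k) (A : set (rVm R k)) : M \in unitmx -> measurable A ->
  vol k A = (`|\det M|%:E * vol k [set x | A (x *m M)])%E.
Proof.
by move=> uM /(vol_affine 0 uM) ->; under eq_set do rewrite addr0.
Qed.

Lemma vol_translate k (b : 'rV[R]_k) (A : set (rVm R k)) : measurable A ->
  vol k [set x | A (x + b)] = vol k A.
Proof.
move=> mA; rewrite [RHS](vol_affine b (unitmx1 _ _) mA) det1 normr1 mul1e.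
by congr (vol k _); apply: eq_set => x; rewrite mulmx1.
Qed.

Lemma vol_scale k (c : R) (A : set (rVm R k)) : 0 < c -> measurable A ->
  vol k A = ((c ^+ k)%:E * vol k [set x | A (c *: x)])%E.
Proof.
move=> c0 mA; rewrite (@vol_linear _ c%:M)//; last first.
  by rewrite unitmxE det_scalar unitrX// unitfE gt_eqF.
rewrite det_scalar gtr0_norm ?exprn_gt0//; congr (_ * vol k _)%E.
by apply: eq_set => x; rewrite mul_mx_scalar.
Qed.

(** * Boxes, half-spaces and hyperplanes *)

Lemma consrV0 k (p : measurableTypeR R * rVm R k) : consrV p 0 0 = p.1.
Proof. by rewrite -[in RHS](consrVK p). Qed.

Lemma consrV_lift k (p : measurableTypeR R * rVm R k) i :
  consrV p 0 (lift 0 i) = p.2 0 i.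
Proof.
rewrite /consrV mxE; case: fintype.splitP => j /= E.
  by move: (ltn_ord j); rewrite -E /bump leq0n.
by congr (p.2 _ _); apply/val_inj/(@addnI 1); rewrite -E.
Qed.

Lemma dotpE k (x y : 'rV[R]_k) : dotp x y = \sum_i x 0 i * y 0 i.
Proof. by rewrite /dotp mxE; apply: eq_bigr => i _; rewrite mxE. Qed.

Lemma measurable_dotp k (u : 'rV[R]_k) :
  measurable_fun setT (fun x : rVm R k => dotp x u : measurableTypeR R).
Proof.
rewrite (_ : (fun _ => _) = fun x : rVm R k => \sum_j x 0 j * u 0 j); last first.
  by apply/funext => x; rewrite dotpE.
apply: measurable_sum => j.
by apply: measurable_funM; [exact: measurable_coord|exact: measurable_cst].
Qed.

Lemma measurable_halfspace k (u : 'rV[R]_k) (c : R) :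
  measurable ([set x | dotp x u <= c] : set (rVm R k)).
Proof.
have := measurable_dotp u measurableT (@measurable_itv R `]-oo, c]).
by rewrite setTI; congr measurable; apply/seteqP; split=> x /=; rewrite in_itv.
Qed.

Lemma measurable_hyperplane k (u : 'rV[R]_k) (c : R) :
  measurable ([set x | dotp x u = c] : set (rVm R k)).
Proof.
by have := measurable_dotp u measurableT (@measurable_set1 R c); rewrite setTI.
Qed.

Lemma vol_box k (a b : 'I_k -> R) : (forall i, a i <= b i) ->
  vol k [set x | forall i, a i <= x 0 i <= b i] = (\prod_i (b i - a i))%:E.
Proof.
elim: k a b => [|k IH] a b ab.
  by rewrite big_ord0 /vol /= indicE mem_set// => -[].
rewrite vol_sections big_ord_recl EFinM.
pose I := `[a 0, b 0]%classic : set (measurableTypeR R).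
pose c := (\prod_(i < k) (b (lift ord0 i) - a (lift ord0 i)))%:E.
rewrite (eq_integral (fun t => (\1_I t)%:E * c)%E); last first.
  move=> t _; rewrite indicE; have [tI|tI] := boolP (t \in I).
    rewrite mul1e /c -IH//; congr (vol k _); apply/seteqP.
    split=> y /= h i; first by have := h (lift 0 i); rewrite consrV_lift.
    have [j ->|->] := unliftP 0 i; first by rewrite consrV_lift.
    by rewrite consrV0 /=; move: tI; rewrite inE /I /= in_itv.
  rewrite mul0e (_ : [set y | _] = set0) ?measure0// -subset0 => y /= /(_ 0).
  by rewrite consrV0 => h; move/negP: tI; apply; rewrite inE /I /= in_itv.
rewrite ge0_integralZr//; last 2 first.
- by apply/measurable_EFinP; apply: measurable_indic; exact: measurable_itv.
- by rewrite lee_fin; apply: prodr_ge0 => i _; rewrite subr_ge0.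
rewrite integral_indic; [|exact: measurableT|exact: measurable_itv].
rewrite setIT; have := @lebesgue_measure_itv R `[a 0, b 0]; rewrite -/I /= lte_fin => ->.
congr (_ * _)%E; case: ltgtP (ab 0) => //= -> _; by rewrite subrr.
Qed.

(** By induction on the dimension: unless u is a multiple of the first basis
vector, all sections are null by induction; if it is, only one is nonempty. *)
Lemma vol_hyperplane k (u : 'rV[R]_k) (c : R) : u != 0 ->
  vol k [set x | dotp x u = c] = 0%E.
Proof.
elim: k u c => [|k IH] u c u0; first by rewrite [u]thinmx0 eqxx in u0.
have dotp_consrV t y : dotp (consrV (t, y)) u = t * u 0 0 + dotp y (rsubmx (u : 'rV_(1 + k))).
  rewrite !dotpE big_ord_recl consrV0; congr (_ + _); apply: eq_bigr => i _.
  rewrite consrV_lift mxE; congr (_ * u _ _); exact/val_inj.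
rewrite vol_sections.
under eq_integral => t _.
  rewrite (_ : [set y | _] = [set y | t * u 0 0 + dotp y (rsubmx (u : 'rV_(1 + k))) = c]).
    over.
  by apply: eq_set => y /=; rewrite dotp_consrV.
have [u'0|u'0] := eqVneq (rsubmx (u : 'rV_(1 + k))) 0; last first.
  rewrite integral0_eq// => t _; rewrite -[RHS](IH _ (c - t * u 0 0) u'0).
  by congr (vol k _); apply: eq_set => y; apply/propext; split => [<-|->]; ring.
have u00 : u 0 0 != 0.
  apply: contra u0 => /eqP u00; apply/eqP/rowP => i; rewrite mxE.
  have [j ->|->] := unliftP 0 i => //.
  have := congr1 (fun v : 'rV_k => v 0 j) u'0; rewrite !mxE => <-.
  by congr (u _ _); apply/val_inj.
pose I := [set c / u 0 0] : set (measurableTypeR R).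
rewrite (eq_integral ((fun=> vol k setT) \_ I)) => [|t _].
  rewrite -integral_mkcond null_set_integral//; [exact: measurable_set1|].
  exact: lebesgue_measure_set1.
have dotp0 y : dotp y (rsubmx (u : 'rV_(1 + k))) = 0.
  by rewrite u'0 dotpE big1// => i _; rewrite mxE mulr0.
rewrite patchE; case: ifPn => tI; [|rewrite /= -[RHS](measure0 (vol k))]; congr (vol k _).
  apply/seteqP; split => // y _ /=; move: tI; rewrite inE /I /= => ->.
  by rewrite dotp0 addr0 divfK.
rewrite -subset0 => y /=; rewrite dotp0 addr0 => h; move/negP: tI; apply.
by rewrite inE /I /= -h mulfK.
Qed.
End volume_is_a_measure.
Arguments vol {R}.

(** * The scalar product *)

Section dot_product.
Context {R : realType} {k : nat}.
Implicit Types x y z : 'rV[R]_k.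

Lemma dotpC x y : dotp x y = dotp y x.
Proof. by rewrite !dotpE; apply: eq_bigr => i _; rewrite mulrC. Qed.

Lemma dotpDl x y z : dotp (x + y) z = dotp x z + dotp y z.
Proof. by rewrite /dotp mulmxDl mxE. Qed.

Lemma dotpZl c x y : dotp (c *: x) y = c * dotp x y.
Proof. by rewrite /dotp -scalemxAl mxE. Qed.

Lemma dotpNl x y : dotp (- x) y = - dotp x y.
Proof. by rewrite -scaleN1r dotpZl mulN1r. Qed.

Lemma dotpDr x y z : dotp z (x + y) = dotp z x + dotp z y.
Proof. by rewrite dotpC dotpDl !(dotpC z). Qed.

Lemma dotpZr c x y : dotp y (c *: x) = c * dotp y x.
Proof. by rewrite dotpC dotpZl dotpC. Qed.

Lemma dotpNr x y : dotp y (- x) = - dotp y x.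
Proof. by rewrite dotpC dotpNl dotpC. Qed.

Lemma dotp0l x : dotp 0 x = 0.
Proof. by rewrite -(scale0r x) dotpZl mul0r. Qed.

Lemma dotp0r x : dotp x 0 = 0.
Proof. by rewrite dotpC dotp0l. Qed.

Lemma dotp_sumr (I : Type) (r : seq I) (P : pred I) (F : I -> 'rV[R]_k) x :
  dotp x (\sum_(i <- r | P i) F i) = \sum_(i <- r | P i) dotp x (F i).
Proof. exact: (big_morph _ (fun a b => dotpDr a b x) (dotp0r x)). Qed.

Lemma dotp_suml (I : Type) (r : seq I) (P : pred I) (F : I -> 'rV[R]_k) x :
  dotp (\sum_(i <- r | P i) F i) x = \sum_(i <- r | P i) dotp (F i) x.
Proof. exact: (big_morph _ (fun a b => dotpDl a b x) (dotp0l x)). Qed.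

Lemma dotp_ge0 x : 0 <= dotp x x.
Proof. by rewrite dotpE; apply: sumr_ge0 => i _; exact: sqr_ge0. Qed.

Lemma dotp_eq0 x : (dotp x x == 0) = (x == 0).
Proof.
apply/eqP/eqP => [|->]; last by rewrite dotp0l.
rewrite dotpE => /eqP; rewrite psumr_eq0 => [/allP h|i _]; last exact: sqr_ge0.
apply/rowP => i; rewrite mxE; apply/eqP.
by have := h i (mem_index_enum i); rewrite -expr2 sqrf_eq0.
Qed.

Lemma dotp_gt0 x : x != 0 -> 0 < dotp x x.
Proof. by move=> x0; rewrite lt_neqAle dotp_ge0 eq_sym dotp_eq0 x0. Qed.

Lemma dotp_CauchySchwarz x y : dotp x y ^+ 2 <= dotp x x * dotp y y.
Proof.
have [->|y0] := eqVneq y 0; first by rewrite !dotp0r mulr0 expr0n.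
have yy := dotp_gt0 y0.
have := dotp_ge0 (dotp y y *: x - dotp x y *: y).
rewrite dotpDl !dotpDr !dotpNl !dotpNr !dotpZl !dotpZr (dotpC y x).
set a := dotp x x; set b := dotp x y; set c := dotp y y in yy *.
have -> : c * (c * a) - c * (b * b) + (- (b * (c * b)) - - (b * (b * c))) = c * (a * c - b ^+ 2).
  by ring.
by rewrite pmulr_rge0// subr_ge0.
Qed.

Lemma dotp_unit_le1 x y : dotp x x = 1 -> dotp y y = 1 -> `|dotp x y| <= 1.
Proof.
move=> hx hy; rewrite -[leRHS]sqrtr1 -sqrtr_sqr ler_sqrt//.
by have := dotp_CauchySchwarz x y; rewrite hx hy mulr1.
Qed.

End dot_product.

Lemma dotp_mulmxl (R : realType) k l (x : 'rV[R]_k) (A : 'M[R]_(k, l)) (y : 'rV[R]_l) :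
  dotp (x *m A) y = dotp x (y *m A^T).
Proof. by rewrite /dotp trmx_mul trmxK mulmxA. Qed.

(** * Volumes of polyhedra *)

Definition polyhedron (R : realType) (k N : nat) (u : 'I_N -> 'rV[R]_k)
    (h : 'I_N -> R) : set 'rV[R]_k :=
  [set x | forall i, dotp x (u i) <= h i].

Section polyhedron_volume.
Context {R : realType} {k N : nat} (u : 'I_N -> 'rV[R]_k).
Implicit Types h : 'I_N -> R.

Definition polyhedron_vol h : R := fine (vol k (polyhedron u h)).

Lemma measurable_forall (T : finType) d (X : measurableType d) (A : T -> set X) :
  (forall i, measurable (A i)) -> measurable [set x | forall i, A i x].
Proof.
move=> mA; rewrite (_ : [set x | _] = \bigcap_(i in setT) A i).
  exact: fin_bigcap_measurable.
by apply/seteqP; split => x Ax i; [move=> _; exact: Ax|exact: (Ax i)].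
Qed.

Lemma measurable_polyhedron h : measurable (polyhedron u h : set (rVm R k)).
Proof. by apply: measurable_forall => i; exact: measurable_halfspace. Qed.

Lemma vol_le (A B : set (rVm R k)) : measurable A -> measurable B ->
  A `<=` B -> (vol k A <= vol k B)%E.
Proof. by move=> mA mB AB; apply: le_measure; rewrite ?inE. Qed.

Lemma polyhedron_sub h h' : (forall i, h i <= h' i) -> polyhedron u h `<=` polyhedron u h'.
Proof. by move=> hh' x hx i; exact: le_trans (hx i) (hh' i). Qed.

Lemma vol_bounded (A : set (rVm R k)) (c : R) : measurable A ->
  (forall x, A x -> forall i, `|x 0 i| <= c) -> (vol k A < +oo)%E.
Proof.
move=> mA Ac; pose c' := Num.max c 0.
have c'0 : 0 <= c' by rewrite le_max lexx orbT.
apply: (@le_lt_trans _ _ (vol k [set x | forall i, - c' <= x 0 i <= c'])); last first.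
  by rewrite vol_box ?ltry// => i; rewrite ge0_cp.
apply: vol_le => //.
  apply: measurable_forall => i.
  have := @measurable_coord R k i measurableT _ (@measurable_itv R `[- c', c']).
  by rewrite setTI; congr measurable; apply/seteqP; split=> x /=; rewrite in_itv.
by move=> x Ax i; rewrite -ler_norml (le_trans (Ac _ Ax i))// le_max lexx.
Qed.

(** The polyhedron contains the box of radius r around the origin. *)
Lemma vol_polyhedron_gt0 h : (forall i, 0 < h i) -> (0 < vol k (polyhedron u h))%E.
Proof.
move=> h0.
(* A bound for x . u_i on the unit box; the 1 keeps it positive. *)
pose w i := 1 + \sum_j `|u i 0 j|.
have w0 i : 0 < w i by rewrite ltr_pwDl// sumr_ge0.
have [r r0 hr] : exists2 r : R, 0 < r & forall i, r * w i <= h i.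
  exists (\big[Num.min/1]_i (h i / w i)).
    by apply: lt_bigmin => // i _; rewrite divr_gt0.
  by move=> i; rewrite -ler_pdivlMr//; exact: bigmin_le_cond.
apply: (@lt_le_trans _ _ (vol k [set x | forall i, - r <= x 0 i <= r])).
  rewrite vol_box => [|i]; last by rewrite ge0_cp// ltW.
  by rewrite lte_fin; apply: prodr_gt0 => i _; rewrite opprK addr_gt0.
apply: vol_le.
- apply: measurable_forall => i.
  have := @measurable_coord R k i measurableT _ (@measurable_itv R `[- r, r]).
  by rewrite setTI; congr measurable; apply/seteqP; split=> x /=; rewrite in_itv.
- exact: measurable_polyhedron.
move=> x hx i; apply: le_trans (hr i); rewrite dotpE.
rewrite /w mulrDr mulr1 ler_wpDl ?(ltW r0)// mulr_sumr; apply: ler_sum => j _.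
rewrite (le_trans (ler_norm _))// normrM ler_wpM2r//.
by rewrite ler_norml.
Qed.

Lemma vol_polyhedron_scale h c : 0 < c ->
  vol k (polyhedron u (fun i => c * h i)) = ((c ^+ k)%:E * vol k (polyhedron u h))%E.
Proof.
move=> c0; rewrite (vol_scale c0 (measurable_polyhedron _)).
congr (_ * vol k _)%E; apply/seteqP; split => x hx i.
  by have := hx i; rewrite dotpZl ler_pM2l.
by rewrite dotpZl ler_pM2l.
Qed.

Lemma vol_polyhedron_translate h z :
  vol k (polyhedron u (fun i => h i - dotp z (u i))) = vol k (polyhedron u h).
Proof.
rewrite -(vol_translate z (measurable_polyhedron h)); congr (vol k _).
by apply/seteqP; split => x hx i; have := hx i; rewrite /= dotpDl lerBrDr.
Qed.

(** The linear map x |-> (x . u_(f i))_i sends A into a box. *)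
Lemma vol_basis_bound (f : 'I_k -> 'I_N) (c : 'I_k -> R) (A : set (rVm R k)) :
  (\matrix_i u (f i) \in unitmx) -> measurable A -> (forall i, 0 <= c i) ->
  (forall x, A x -> forall i, `|dotp x (u (f i))| <= c i) ->
  (vol k A <= (`|\det (\matrix_i u (f i))|^-1 * \prod_i (c i *+ 2))%:E)%E.
Proof.
move=> uW mA c0 Ac; set W := \matrix_i _ in uW *.
have dW : 0 < `|\det W| by rewrite normr_gt0 -unitfE -unitmxE.
pose B := [set x : rVm R k | forall i, - c i <= x 0 i <= c i].
have mB : measurable B.
  apply: measurable_forall => i.
  have := @measurable_coord R k i measurableT _ (@measurable_itv R `[- c i, c i]).
  by rewrite setTI; congr measurable; apply/seteqP; split=> x /=; rewrite in_itv.
have WT : W^T \in unitmx by rewrite unitmx_tr.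
have mWB : measurable ([set x | B (x *m W^T)] : set (rVm R k)).
  exact: measurable_preimage_linear.
have AB : (vol k A <= vol k [set x | B (x *m W^T)])%E.
  apply: vol_le => // x Ax i; rewrite -ler_norml; have := Ac _ Ax i.
  congr (`|_| <= _); rewrite dotpE mxE; apply: eq_bigr => j _; by rewrite !mxE.
apply: (le_trans AB).
have := vol_linear WT mB; rewrite det_tr vol_box => [|i]; last by rewrite ge0_cp.
under [in X in X = _ -> _]eq_bigr do rewrite opprK -mulr2n.
move=> E; rewrite EFinM E muleA -EFinM mulVf ?gt_eqF// mul1e //.
Qed.

End polyhedron_volume.

(** * Orthonormal coordinates adapted to a hyperplane *)

Section orthonormal_coordinates.
Context {R : realType} {n : nat}.
Variables (v : 'rV[R]_n.+1) (B : 'M[R]_(n, n.+1)).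
Hypotheses (v1 : dotp v v = 1) (Bv : orthonormal_basis_perp v B).

Definition frame : 'M[R]_(1 + n, n.+1) := col_mx v B.

Lemma frame_orthogonal : frame *m frame^T = 1%:M.
Proof.
have [BB Bv0] := Bv.
rewrite /frame tr_col_mx mul_col_row BB Bv0.
have -> : v *m B^T = 0 by rewrite -[LHS]trmxK trmx_mul trmxK Bv0 trmx0.
have -> : v *m v^T = 1%:M.
  by apply/matrixP => i j; rewrite (ord1 i) (ord1 j) [RHS]mxE eqxx; exact: v1.
by rewrite -scalar_mx_block.
Qed.

Lemma frame_unit : frame \in unitmx.
Proof. by case/mulmx1_unit: frame_orthogonal. Qed.

Lemma norm_det_frame : `|\det (frame : 'M[R]_n.+1)| = 1.
Proof.
have /(congr1 determinant) := frame_orthogonal.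
rewrite det_mulmx det_tr det1 -expr2 => /eqP.
by rewrite sqrf_eq1 => /orP[] /eqP ->; rewrite ?normrN normr1.
Qed.

Lemma mulmx_frame t (y : 'rV[R]_n) : consrV (t, y) *m frame = t *: v + y *m B.
Proof. by rewrite /consrV /frame (@mul_row_col _ 1 1 n) mul_scalar_mx. Qed.

Lemma perp_dotp y : dotp (y *m B) v = 0.
Proof. by have [_ Bv0] := Bv; rewrite /dotp -mulmxA Bv0 mulmx0 mxE. Qed.

Lemma frame_coord t y : dotp (t *: v + y *m B) v = t.
Proof. by rewrite dotpDl dotpZl v1 mulr1 perp_dotp addr0. Qed.

Lemma frame_proj t y : (t *: v + y *m B) *m B^T = y.
Proof.
have [BB Bv0] := Bv.
have vB0 : v *m B^T = 0 by rewrite -[LHS]trmxK trmx_mul trmxK Bv0 trmx0.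
by rewrite mulmxDl -scalemxAl vB0 scaler0 add0r -mulmxA BB mulmx1.
Qed.

Lemma frame_decomp x : x = dotp x v *: v + x *m B^T *m B.
Proof.
have /mulmx1C E := frame_orthogonal.
rewrite -[LHS]mulmx1 -E mulmxA /frame tr_col_mx mul_mx_row mul_row_col.
by congr (_ + _); rewrite -mul_scalar_mx; congr (_ *m _); apply/matrixP => i j;
  rewrite (ord1 i) (ord1 j) !mxE eqxx mulr1n /dotp mxE.
Qed.

Lemma vol_slab (a b : R) (D : set (rVm R n)) : a <= b -> measurable D ->
  vol n.+1 [set x | a < dotp x v <= b /\ D (x *m B^T)] = ((b - a)%:E * vol n D)%E.
Proof.
move=> ab mD; set E := [set x | _].
have mE : measurable (E : set (rVm R n.+1)).
  rewrite (_ : E = (fun x => dotp x v) @^-1` `]a, b] `&` [set x | D (x *m B^T)]).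
    apply: measurableI; last exact: measurable_preimage_linear.
    by have := @measurable_dotp R _ v measurableT _ (@measurable_itv R `]a, b]); rewrite setTI.
  by apply/seteqP; split=> x [] /=; rewrite in_itv.
rewrite (vol_linear frame_unit mE) norm_det_frame mul1e.
rewrite [LHS]lebesgue_volS.
rewrite (_ : _ @^-1` _ = `]a, b]%classic `*` D).
  rewrite -[LHS]/((lebesgue_measure \x vol n)%E _) product_measure1E//; congr (_ * _)%E.
  have := @lebesgue_measure_itv R `]a, b]; rewrite /= lte_fin => ->.
  by case: ltgtP ab => //= -> _; rewrite subrr.
by apply/seteqP; split=> -[t y] /=; rewrite mulmx_frame /E /= frame_coord frame_proj in_itv.
Qed.

End orthonormal_coordinates.

Lemma orthonormal_basis_perp_ex (R : realType) (n : nat) (v : 'rV[R]_n.+1) :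
  dotp v v = 1 -> exists B, orthonormal_basis_perp v B.
Proof.
move=> v1.
suff [H [HH H0]] : exists H : 'M[R]_(1 + n, n.+1), H *m H^T = 1%:M /\ usubmx H = v.
  have := HH; rewrite -{1 2}(vsubmxK H) tr_col_mx mul_col_row H0 => E.
  exists (dsubmx H); split.
    by have := congr1 drsubmx E; rewrite block_mxKdr [1%:M]scalar_mx_block block_mxKdr.
  by have := congr1 dlsubmx E; rewrite block_mxKdl [1%:M]scalar_mx_block block_mxKdl.
have usub (H : 'M[R]_(1 + n, n.+1)) : row 0 H = v -> usubmx H = v.
  move=> <-; apply/rowP => j; rewrite !mxE; congr (H _ _); exact/val_inj.
pose e : 'rV[R]_n.+1 := delta_mx 0 0.
have ee : dotp e e = 1.
  by rewrite dotpE (bigD1 0)//= big1 => [|i i0]; rewrite !mxE ?eqxx ?(negPf i0) /= ?mulr0// mulr1 addr0.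
have [ve|ve] := eqVneq v e.
  exists 1%:M; rewrite trmx1 mulmx1; split=> //; apply: usub.
  by rewrite row1 ve.
(* The reflection in the hyperplane orthogonal to v - e exchanges e and v. *)
pose w := v - e.
have ww : dotp w w != 0 by rewrite dotp_eq0 subr_eq0.
pose P : 'M[R]_n.+1 := (2 / dotp w w) *: (w^T *m w).
have PT : P^T = P by rewrite /P linearZ /= trmx_mul trmxK.
have PP : P *m P = P *+ 2.
  rewrite /P -scalemxAl -scalemxAr mulmxA -(mulmxA w^T) [w *m w^T]mx11_scalar.
  rewrite mul_mx_scalar -scalemxAl -[(w *m w^T) 0 0]/(dotp w w).
  move: (w^T *m w) => W; apply/matrixP => i j.
  by rewrite mulr2n !mxE; field.
exists (1%:M - P); split.
  rewrite linearB /= trmx1 PT (@mulmxBl _ n.+1 n.+1 n.+1) (@mulmxBr _ n.+1 n.+1 n.+1 P).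
  rewrite mul1mx mulmx1 PP; move: (P) => Q; apply/matrixP => i j.
  by rewrite mulr2n !mxE; ring.
apply: usub; rewrite rowE mulmxBr mulmx1 /P -scalemxAr mulmxA.
have -> : (delta_mx 0 0 : 'rV[R]_n.+1) *m w^T = (dotp e w)%:M.
  exact: mx11_scalar.
rewrite mul_scalar_mx scalerA.
have E : dotp w w = - 2 * dotp e w.
  rewrite /w dotpDl !dotpDr !dotpNl !dotpNr v1 ee (dotpC v e).
  ring.
have ew : dotp e w != 0 by apply: contra ww => /eqP ew; rewrite E ew mulr0.
have -> : 2 / dotp w w * dotp e w = -1 by rewrite E; field.
by rewrite scaleN1r opprK /w addrC subrK.
Qed.

(** * Volume change under displacement of one facet *)

Section facet_area.
Context {R : realType} {n N : nat}.
Variables (u : 'I_N -> 'rV[R]_n.+1) (h : 'I_N -> R) (i0 : 'I_N).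
Variable B : 'M[R]_(n, n.+1).
Hypothesis u1 : forall i, dotp (u i) (u i) = 1.
Hypothesis h0 : forall i, 0 < h i.
Hypothesis u_neq : forall j, j != i0 -> u j != u i0.
Hypothesis Bperp : orthonormal_basis_perp (u i0) B.
Hypothesis bounded_P : forall h' : 'I_N -> R, exists c : R,
  forall x, polyhedron u h' x -> forall j, `|x 0 j| <= c.

(** The i0-th facet of the polyhedron in the coordinates given by B, with the other
constraints relaxed by delta (strengthened when delta < 0). *)
Definition facet_slice (delta : R) : set (rVm R n) :=
  [set y | forall j, j != i0 -> dotp (h i0 *: u i0 + y *m B) (u j) <= h j + delta].

Definition shift_facet (t : R) : 'I_N -> R := fun j => h j + t *+ (j == i0).

Lemma measurable_facet_slice delta : measurable (facet_slice delta).
Proof.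
pose A j := [set y : rVm R n |
  j != i0 -> dotp (h i0 *: u i0 + y *m B) (u j) <= h j + delta].
apply: (@measurable_forall _ _ _ A) => j; have [->|ji] := eqVneq j i0.
  rewrite (_ : A i0 = setT); first exact: measurableT.
  by apply/seteqP; split=> y _ //; rewrite /A /= eqxx.
have := @measurable_preimage_affine R n n.+1 B (h i0 *: u i0) _
  (measurable_halfspace (u j) (h j + delta)).
congr measurable; apply/seteqP; split => y; rewrite /A /= addrC //.
by move=> /(_ ji).
Qed.

Lemma facet_slice_sub delta delta' : delta <= delta' ->
  facet_slice delta `<=` facet_slice delta'.
Proof. by move=> dd' y hy j ji; rewrite (le_trans (hy j ji))// lerD2l. Qed.

Lemma facet_slice_finite delta : (vol n (facet_slice delta) < +oo)%E.
Proof.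
have [c hc] := bounded_P (fun j => h j + `|delta|).
pose C := \sum_j \sum_i `|c| * `|B i j|.
apply: (@vol_bounded _ _ _ C); first exact: measurable_facet_slice.
move=> y hy i; pose x := h i0 *: u i0 + y *m B.
have hx : polyhedron u (fun j => h j + `|delta|) x.
  move=> j; have [->|ji] := eqVneq j i0; first by rewrite frame_coord// lerDl.
  by rewrite (le_trans (hy j ji))// lerD2l ler_norm.
have -> : y = x *m B^T by rewrite frame_proj.
rewrite mxE (le_trans (ler_norm_sum _ _ _))//; apply: ler_sum => j _.
rewrite normrM [B^T _ _]mxE; apply: (@le_trans _ _ (`|c| * `|B i j|)); last first.
  by rewrite (bigD1 i)//= lerDl sumr_ge0// => *; rewrite mulr_ge0.
by rewrite ler_wpM2r// (le_trans (hc _ hx j))// ler_norm.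
Qed.

(** When the i0-th constraint moves outwards by t <= delta, the polyhedron gains at
least a slab of width t over the facet whose other constraints are strengthened
by delta: moving by t along the unit vector u_i0 changes x . u_j by at most t. *)
Lemma slab_lower t delta : 0 <= t <= delta ->
  (vol n.+1 (polyhedron u h) + t%:E * vol n (facet_slice (- delta)) <=
   vol n.+1 (polyhedron u (shift_facet t)))%E.
Proof.
move=> /andP[t0 td].
have le1 : h i0 <= h i0 + t by rewrite lerDl.
have := vol_slab (u1 i0) Bperp le1 (measurable_facet_slice (- delta)).
rewrite addrAC subrr add0r; set S := [set x | _] => <-.
have mS : measurable (S : set (rVm R n.+1)).
  rewrite (_ : S = (fun x => dotp x (u i0)) @^-1` `]h i0, h i0 + t] `&`
    [set x | facet_slice (- delta) (x *m B^T)]); last first.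
    by apply/seteqP; split=> x [] /=; rewrite in_itv.
  apply: measurableI; last exact: measurable_preimage_linear (measurable_facet_slice _).
  by have := @measurable_dotp R _ (u i0) measurableT _ (@measurable_itv R `]h i0, h i0 + t]); rewrite setTI.
rewrite -measureU//; last 2 first.
- exact: measurable_polyhedron.
- rewrite -subset0 => x [hx [/andP[]]]; by rewrite ltNge hx.
apply: vol_le; [by apply: measurableU => //; exact: measurable_polyhedron|
  exact: measurable_polyhedron|].
move=> x [hx|[/andP[x1 x2] xS]] j; rewrite /shift_facet.
  by rewrite (le_trans (hx j))// lerDl; case: (_ == _).
have [->|ji] := eqVneq j i0; first by rewrite mulr1n.
rewrite mulr0n addr0 [x](frame_decomp (u1 i0) Bperp).
have := xS j ji; rewrite !dotpDl !dotpZl.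
set a := dotp x (u i0) in x1 x2 *; set p := dotp (u i0) (u j).
set q := dotp _ _; move=> hq.
have : `|p| <= 1 by exact: dotp_unit_le1.
rewrite ler_norml => /andP[p1 p2].
have : (a - h i0) * p <= (a - h i0) * 1 by rewrite ler_wpM2l// subr_ge0 ltW.
by nra.
Qed.

(** Conversely, when the constraint moves inwards by t, what is lost lies in a slab
of width t over the relaxed facet. *)
Lemma slab_upper t delta : 0 <= t <= delta ->
  (vol n.+1 (polyhedron u h) <=
   vol n.+1 (polyhedron u (shift_facet (- t))) + t%:E * vol n (facet_slice delta))%E.
Proof.
move=> /andP[t0 td].
have le1 : h i0 - t <= h i0 by rewrite lerBlDr lerDl.
have := vol_slab (u1 i0) Bperp le1 (measurable_facet_slice delta).
have -> : h i0 - (h i0 - t) = t by ring.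
set S := [set x | _] => <-.
have mS : measurable (S : set (rVm R n.+1)).
  rewrite (_ : S = (fun x => dotp x (u i0)) @^-1` `]h i0 - t, h i0] `&`
    [set x | facet_slice delta (x *m B^T)]); last first.
    by apply/seteqP; split=> x [] /=; rewrite in_itv.
  apply: measurableI; last exact: measurable_preimage_linear (measurable_facet_slice _).
  by have := @measurable_dotp R _ (u i0) measurableT _ (@measurable_itv R `]h i0 - t, h i0]); rewrite setTI.
apply: (@le_trans _ _ (vol n.+1 (polyhedron u (shift_facet (- t)) `|` S))); last first.
  by apply: measureU2 => //; exact: measurable_polyhedron.
apply: vol_le; [exact: measurable_polyhedron|
  by apply: measurableU => //; exact: measurable_polyhedron|].
move=> x hx; have [xt|xt] := leP (dotp x (u i0)) (h i0 - t); [left|right].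
  move=> j; rewrite /shift_facet; have [->|ji] := eqVneq j i0; first by rewrite mulr1n.
  by rewrite mulr0n addr0; exact: hx.
split; first by rewrite xt hx.
move=> j ji; have := hx j; rewrite {1}[x](frame_decomp (u1 i0) Bperp).
rewrite !dotpDl !dotpZl; have := hx i0.
set a := dotp x (u i0) in xt *; set p := dotp (u i0) (u j).
set q := dotp _ _; move=> ha hq.
have : `|p| <= 1 by exact: dotp_unit_le1.
rewrite ler_norml => /andP[p1 p2].
have : (h i0 - a) * p <= (h i0 - a) * 1 by rewrite ler_wpM2l// subr_ge0.
by nra.
Qed.

(** The other constraints meet the hyperplane of the facet in null sets: u_j is not
u_i0, and if u_j = - u_i0 then the two hyperplanes are on opposite sides of the
origin, because h > 0. *)
Lemma vol_ridge j : j != i0 ->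
  vol n [set y | dotp (h i0 *: u i0 + y *m B) (u j) = h j] = 0%E.
Proof.
move=> ji.
have [b0|b0] := eqVneq (u j *m B^T) 0; last first.
  rewrite -[RHS](vol_hyperplane (h j - h i0 * dotp (u i0) (u j)) b0).
  congr (vol n _); apply: eq_set => y; rewrite dotpDl dotpZl dotp_mulmxl.
  by apply/propext; split => [<-|->]; ring.
rewrite (_ : [set y | _] = set0) ?measure0// -subset0 => y /=.
rewrite dotpDl dotpZl dotp_mulmxl b0 dotp0r addr0.
have := frame_decomp (u1 i0) Bperp (u j); rewrite b0 mul0mx addr0 => ujE.
have := u1 j; rewrite {1 2}ujE dotpZl dotpZr u1 mulr1 -expr2 => /eqP.
rewrite sqrf_eq1 => /orP[] /eqP p1.
  by have := u_neq ji; rewrite ujE p1 scale1r eqxx.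
rewrite dotpC p1 mulrN1 => hh.
by have := addr_gt0 (h0 i0) (h0 j); rewrite -hh subrr ltxx.
Qed.

(** Continuity from above: the relaxed facets decrease to the facet. *)
Lemma facet_slice_ge (c : \bar R) :
  (forall delta : R, (0 < delta)%R -> c <= vol n (facet_slice delta))%E ->
  (c <= vol n (facet_slice 0))%E.
Proof.
move=> hc; pose F m := facet_slice (m.+1%:R^-1).
have F0 : \bigcap_m F m = facet_slice 0.
  apply/seteqP; split => y hy; last first.
    by move=> m _; apply: facet_slice_sub hy; rewrite invr_ge0.
  move=> j ji; rewrite addr0 leNgt; apply/negP => lt.
  have [m] := @ltr_add_invr R _ _ lt.
  by apply/negP; rewrite -leNgt; exact: (hy m I j ji).
have mF m : measurable (F m) by exact: measurable_facet_slice.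
have : (vol n \o F) m @[m --> \oo] --> vol n (\bigcap_m F m).
  apply: nonincreasing_cvg_mu => //; first exact: facet_slice_finite.
    by rewrite F0; exact: measurable_facet_slice.
  move=> a b ab; apply/subsetPset; apply: facet_slice_sub.
  by rewrite lef_pV2 ?posrE// ler_nat.
rewrite F0; apply: cvge_ge; apply: nearW => m /=.
by apply: hc; rewrite invr_gt0.
Qed.

(** Continuity from below: the strengthened facets increase to the facet deprived of
its ridges, which are null. *)
Lemma facet_slice_le (c : \bar R) :
  (forall delta : R, (0 < delta)%R -> vol n (facet_slice (- delta)%R) <= c)%E ->
  (vol n (facet_slice 0) <= c)%E.
Proof.
move=> hc; pose F m := facet_slice (- (m.+1%:R^-1)).
have mF m : measurable (F m) by exact: measurable_facet_slice.
have mUF : measurable (\bigcup_m F m) by exact: bigcup_measurable.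
pose H := \big[setU/set0]_(j | j != i0) [set y : rVm R n | dotp (h i0 *: u i0 + y *m B) (u j) = h j].
have [mH vH] : measurable H /\ vol n H = 0%E.
  apply: (big_ind (fun A : set (rVm R n) => measurable A /\ vol n A = 0%E)).
  - by split; [exact: measurable0|exact: measure0].
  - by move=> A1 A2 [m1 v1] [m2 v2]; split; [exact: measurableU|exact: null_set_setU].
  - move=> j ji; split; last exact: vol_ridge.
    have := @measurable_preimage_affine R n n.+1 B (h i0 *: u i0) _
      (measurable_hyperplane (u j) (h j)).
    by congr measurable; apply/seteqP; split => y /=; rewrite addrC.
have sub : facet_slice 0 `<=` \bigcup_m F m `|` H.
  move=> y hy.
  have [[j [ji yj]]|] := pselect (exists j, j != i0 /\ dotp (h i0 *: u i0 + y *m B) (u j) = h j).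
    by right; rewrite /H (bigD1 j)//=; left.
  move=> /forallNP nj; left.
  have lt j : j != i0 -> dotp (h i0 *: u i0 + y *m B) (u j) < h j.
    move=> ji; rewrite lt_neqAle -[X in _ <= X]addr0 (hy j ji) andbT.
    by apply/eqP => E; apply: (nj j).
  pose e := \big[Num.min/1]_(j | j != i0) (h j - dotp (h i0 *: u i0 + y *m B) (u j)).
  have e0 : 0 < e by apply: lt_bigmin => // j ji; rewrite subr_gt0 lt.
  have [m] := @ltr_add_invr R _ _ e0; rewrite add0r => me.
  exists m => // j ji; rewrite lerBrDr -lerBrDl; apply: le_trans (ltW me) _.
  exact: bigmin_le_cond.
apply: (@le_trans _ _ (vol n (\bigcup_m F m))).
  rewrite -(measureU0 mUF mH vH); apply: vol_le => //; last exact: measurableU.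
  exact: measurable_facet_slice.
have : (vol n \o F) m @[m --> \oo] --> vol n (\bigcup_m F m).
  apply: nondecreasing_cvg_mu => //.
  move=> a b ab; apply/subsetPset; apply: facet_slice_sub.
  by rewrite lerN2 lef_pV2 ?posrE// ler_nat.
apply: cvge_le; apply: nearW => m /=.
by apply: hc; rewrite invr_gt0.
Qed.

End facet_area.

(** * Spans of subfamilies and greedy bases *)

Section spans.
Context {R : realType} {n N : nat} (u : 'I_N -> 'rV[R]_n).
Implicit Types I : {set 'I_N}.

Definition span_of I : {vspace 'rV[R]_n} := (\sum_(i in I) <[u i]>)%VS.

Lemma mem_span_of I i : i \in I -> u i \in span_of I.
Proof. by move=> iI; apply: (subvP (sumv_sup i iI (subvv _))); exact: memv_line. Qed.

Lemma dotp_span_of0 I v y : (forall i, i \in I -> dotp (u i) v = 0) -> y \in span_of I ->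
  dotp y v = 0.
Proof.
move=> h /memv_sumP[w hw ->]; rewrite dotp_suml big1// => i iI.
by have /vlineP[c ->] := hw i iI; rewrite dotpZl h// mulr0.
Qed.

Lemma dimv_add_line (X : {vspace 'rV[R]_n}) v :
  \dim (X + <[v]>) = (\dim X + (v \notin X))%N.
Proof.
have [vX|vX] /= := boolP (v \in X).
  by rewrite addn0 (addv_idPl _)// -memvE.
have v0 : v != 0 by apply: contraNneq vX => ->; rewrite mem0v.
rewrite dimv_disjoint_sum ?dim_vline ?v0//.
apply/eqP; rewrite -subv0; apply/subvP => x; rewrite memv_cap => /andP[xX /vlineP[c xE]].
have [c0|c0] := eqVneq c 0; first by rewrite xE c0 scale0r mem0v.
by case/negP: vX; rewrite -[v](scalerK c0) -xE memvZ.
Qed.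

Lemma span_ofU1 I i : i \notin I -> span_of (i |: I) = (span_of I + <[u i]>)%VS.
Proof. by move=> iI; rewrite /span_of big_setU1//= addvC. Qed.

Lemma dim_span_ofU1 I i : i \notin I ->
  \dim (span_of (i |: I)) = (\dim (span_of I) + (u i \notin span_of I))%N.
Proof. by move=> iI; rewrite span_ofU1// dimv_add_line. Qed.

End spans.

Lemma dim_rV (R : realType) n : \dim {:'rV[R]_n} = n.
Proof. by rewrite dimvf dim_matrix mul1r. Qed.

(** A nonzero vector of the kernel of the matrix whose rows form a basis of X. *)
Lemma perp_exists (R : realType) n (X : {vspace 'rV[R]_n}) : (\dim X < n)%N ->
  exists2 v : 'rV[R]_n, v != 0 & forall x, x \in X -> dotp x v = 0.
Proof.
move=> Xn; pose W : 'M[R]_(\dim X, n) := \matrix_i (vbasis X)`_i.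
have : kermx W^T != 0.
  rewrite -mxrank_eq0 mxrank_ker mxrank_tr -lt0n subn_gt0.
  exact: leq_ltn_trans (rank_leq_row _) Xn.
move=> /rowV0Pn[v /sub_kermxP vW v0]; exists v => // x xX.
rewrite (coord_vbasis xX) dotp_suml big1// => i _; rewrite dotpZl.
have /(congr1 (fun A : 'rV_(\dim X) => A 0 i)) := vW; rewrite !mxE => E.
rewrite (_ : dotp _ v = 0) ?mulr0// dotpE -[RHS]E.
by apply: eq_bigr => j _; rewrite !mxE mulrC.
Qed.

Lemma free_unitmx (R : realType) n (b : seq 'rV[R]_n) : free b -> size b = n ->
  (\matrix_(i < n) b`_i) \in unitmx.
Proof.
move=> fb sb; rewrite -row_free_unit; apply: inj_row_free => v.
rewrite mulmx_sum_row => E; apply/rowP => i; rewrite [RHS]mxE.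
move: fb; rewrite -(in_tupleE b) => /freeP/(_ (fun j => v 0 (cast_ord sb j))).
move=> /(_ _ (cast_ord (esym sb) i)); rewrite cast_ordKV; apply.
rewrite -[RHS]E (reindex (cast_ord sb)) /=; last first.
  by exists (cast_ord (esym sb)) => ? _; rewrite ?cast_ordK ?cast_ordKV.
by apply: eq_bigr => j _; rewrite rowK.
Qed.

Lemma abel_summation (R : realType) (w f : nat -> R) m :
  \sum_(k < m) w k * f k =
  (\sum_(k < m) w k) * f m +
  \sum_(k < m) (\sum_(j < k.+1) w j) * (f k - f k.+1).
Proof.
elim: m => [|m IH]; first by rewrite !big_ord0 mul0r addr0.
rewrite big_ord_recr IH [in RHS]big_ord_recr [X in _ = _ + X]big_ord_recr /=.
rewrite [\sum_(j < m.+1) w j]big_ord_recr /=; ring.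
Qed.

Section greedy_basis.
Context {R : realType} {n N : nat} (u : 'I_N -> 'rV[R]_n) (i0 : 'I_N).
Variable s : seq 'I_N.
Hypotheses (us : uniq s) (Ns : size s = N).
Local Notation s_ k := (nth i0 s k).

(** When s lists all indices by increasing h, these are the sublevel sets of h. *)
Definition prefix_set k : {set 'I_N} := [set i in take k s].

Lemma mem_full_uniq i : i \in s.
Proof.
have sub : {subset s <= enum 'I_N} by move=> j _; rewrite mem_enum.
have sz : (size (enum 'I_N) <= size s)%N by rewrite size_enum_ord Ns.
by have [_ ->] := uniq_min_size us sub sz; rewrite mem_enum.
Qed.

Lemma prefix_set0 : prefix_set 0 = finset.set0.
Proof. by apply/setP => i; rewrite !inE take0. Qed.

Lemma prefix_setN : prefix_set N = [set: 'I_N]%SET.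
Proof. by apply/setP => i; rewrite !inE take_oversize ?mem_full_uniq// Ns. Qed.

Lemma prefix_setS k : (k < N)%N -> prefix_set k.+1 = (s_ k |: prefix_set k)%SET.
Proof.
move=> kN; apply/setP => i; rewrite !inE (take_nth i0) ?Ns//.
by rewrite mem_rcons inE.
Qed.

Lemma nth_notin_prefix k : (k < N)%N -> s_ k \notin prefix_set k.
Proof.
move=> kN; rewrite inE; apply/negP => /(nthP i0)[j].
rewrite size_take Ns kN => jk; rewrite nth_take// => /eqP.
by rewrite nth_uniq ?Ns ?(ltn_trans jk)// ltn_eqF.
Qed.

(** The basis obtained by keeping each vector that is not in the span of the
previous ones; it has dim (span) elements among any first k indices, which is
what makes the summation by parts produce [excess]. *)
Definition greedy m : seq 'I_N :=
  [seq s_ k | k <- iota 0 m & u (s_ k) \notin span_of u (prefix_set k)].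

Lemma greedy_span m : (m <= N)%N ->
  free (map u (greedy m)) /\ <<map u (greedy m)>>%VS = span_of u (prefix_set m).
Proof.
elim: m => [|m IH] mN.
  by rewrite /greedy /= nil_free span_nil prefix_set0 /span_of big_set0.
have [fm sm] := IH (ltnW mN).
have iE : iota 0 m.+1 = iota 0 m ++ [:: m] by rewrite -addn1 iotaD.
rewrite /greedy iE filter_cat !map_cat /= -/(greedy m).
rewrite prefix_setS// span_ofU1 ?nth_notin_prefix//.
case: ifPn => h /=; last first.
  rewrite cats0; split=> //; rewrite sm; apply/esym/addv_idPl.
  by rewrite -memvE; apply/negPn.
split; last by rewrite span_cat sm span_seq1.
by rewrite cats1 (perm_free (permEl (perm_rcons _ _))) free_cons sm h.
Qed.

Lemma sum_greedy (F : 'I_N -> R) m :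
  \sum_(i <- greedy m) F i =
  \sum_(k < m) (u (s_ k) \notin span_of u (prefix_set k))%:R * F (s_ k).
Proof.
rewrite /greedy big_map big_filter -{1}[m]subn0 -/(index_iota 0 m) big_mkord.
rewrite big_mkcond; apply: eq_bigr => k _.
by case: (_ \notin _); rewrite ?mul1r ?mul0r.
Qed.

Lemma dim_prefix m : (m <= N)%N -> (\dim (span_of u (prefix_set m)))%:R =
  \sum_(k < m) (u (s_ k) \notin span_of u (prefix_set k))%:R :> R.
Proof.
elim: m => [|m IH] mN; first by rewrite big_ord0 prefix_set0 /span_of big_set0 dimv0.
rewrite big_ord_recr /= -IH ?(ltnW mN)// prefix_setS//.
by rewrite dim_span_ofU1 ?nth_notin_prefix// natrD.
Qed.

Lemma sum_prefix (F : 'I_N -> R) m : (m <= N)%N ->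
  \sum_(i in prefix_set m) F i = \sum_(k < m) F (s_ k).
Proof.
elim: m => [|m IH] mN; first by rewrite big_ord0 prefix_set0 big_set0.
rewrite big_ord_recr /= -IH ?(ltnW mN)// prefix_setS//.
by rewrite big_setU1 ?nth_notin_prefix//= addrC.
Qed.

End greedy_basis.

(** * Critical vectors and the energy *)

Lemma continuous_sum (R : realType) (T : topologicalType) (I : Type) (r : seq I)
    (f : I -> T -> R) (x : T) : (forall i, {for x, continuous (f i)}) ->
  {for x, continuous (fun y => \sum_(i <- r) f i y)}.
Proof.
move=> cf; elim: r => [|i r IH].
  rewrite (_ : (fun y => _) = cst 0); first exact: cvg_cst.
  by apply/funext => y; rewrite big_nil.
rewrite (_ : (fun y => _) = f i \+ (fun y => \sum_(i <- r) f i y)); last first.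
  by apply/funext => y; rewrite big_cons.
by apply: continuousD; [exact: cf|exact: IH].
Qed.

Lemma continuous_dotp (R : realType) n (w : 'rV[R]_n) :
  continuous (fun x : 'rV[R]_n => dotp x w).
Proof.
rewrite (_ : (fun _ => _) = (fun x : 'rV[R]_n => \sum_j x 0 j * w 0 j)); last first.
  by apply/funext => x; rewrite dotpE.
move=> x; apply: continuous_sum => j; apply: continuousM;
  [exact: coord_continuous|exact: cst_continuous].
Qed.

Section log_minkowski_functional.
Context {R : realType} {n N : nat}.
Variables (u : 'I_N -> 'rV[R]_n.+1) (gam : 'I_N -> R).
Hypothesis gam0 : forall i, 0 < gam i.
Hypothesis span_pos : forall v, v != 0 -> exists i, dotp (u i) v < 0.
Implicit Types h : 'I_N -> R.

Definition total_mass := \sum_i gam i.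

(** The derivative at z = 0 of sum_i gamma_i ln (h_i - z . u_i) vanishes. *)
Definition critical h := \sum_i (gam i / h i) *: u i = 0.
Local Notation V := (polyhedron_vol u).

(** Invariant under scaling of h; see [energy_scale]. *)
Definition energy h := \sum_i gam i * ln (h i) - total_mass / n.+1%:R * ln (V h).

Lemma inhabited_index : exists i : 'I_N, True.
Proof.
have [|i _] := @span_pos (delta_mx 0 0); last by exists i.
apply/eqP => /rowP/(_ 0); rewrite !mxE !eqxx /= => /eqP; by rewrite oner_eq0.
Qed.

Lemma total_mass_gt0 : 0 < total_mass.
Proof.
have [i _] := inhabited_index; rewrite /total_mass (bigD1 i)//= ltr_pwDl//.
by apply: sumr_ge0 => j _; exact: ltW.
Qed.

Lemma gam_le_total i : gam i <= total_mass.
Proof. by rewrite /total_mass (bigD1 i)//= lerDl sumr_ge0// => j _; exact: ltW. Qed.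

Lemma critical_dotp h x : critical h -> \sum_i gam i / h i * dotp x (u i) = 0.
Proof.
move=> /(congr1 (fun y => dotp x y)); rewrite dotp0r dotp_sumr => E.
by rewrite -[RHS]E; apply: eq_bigr => i _; rewrite dotpZr.
Qed.

(** Pair the relation sum_i (gamma_i / h_i) u_i = 0 with x: each of its terms is at
most gamma_i on the polyhedron, so each is at least minus the sum of the other
bounds. *)
Lemma critical_bound h x i : (forall i, 0 < h i) -> critical h ->
  polyhedron u h x -> `|dotp x (u i)| <= total_mass / gam i * h i.
Proof.
move=> h0 ch xP; have := critical_dotp x ch; rewrite (bigD1 i)//=.
set S := \sum_(j | _) _ => /eqP; rewrite addr_eq0 => /eqP E.
have SG : S <= total_mass - gam i.
  rewrite /total_mass (bigD1 i)//= addrAC subrr add0r; apply: ler_sum => j _.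
  rewrite mulrAC ler_pdivrMr// ler_pM2l//; exact: xP.
rewrite ler_norml; apply/andP; split; last first.
  rewrite (le_trans (xP i))// ler_peMl ?(ltW (h0 i))// ler_pdivlMr// mul1r.
  exact: gam_le_total.
have -> : dotp x (u i) = h i / gam i * - S.
  by rewrite -E; field; rewrite !gt_eqF.
rewrite mulrN lerN2 mulrAC [leRHS]mulrC mulrA ler_pM2r ?invr_gt0// ler_pM2l//.
by rewrite (le_trans SG)// gerBl ltW.
Qed.

Lemma spans_full : span_of u [set: 'I_N]%SET = fullv.
Proof.
apply/eqP; rewrite -dimv_leqif_eq ?subvf// dim_rV eqn_leq.
rewrite -[X in (_ <= X)%N](dim_rV R) dimvS ?subvf//= leqNgt; apply/negP.
move=> /perp_exists[v v0 hv]; have [i] := span_pos v0.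
by rewrite hv ?ltxx// mem_span_of// inE.
Qed.

(** The sum of the positive parts of the x . u_i is homogeneous, continuous and
positive on the compact unit sphere, hence bounds the norm. *)
Lemma polyhedron_bounded h : exists c : R,
  forall x, polyhedron u h x -> forall j, `|x 0 j| <= c.
Proof.
pose f (v : 'rV[R]_n.+1) := \sum_i Num.max 0 (dotp v (u i)).
have cf : continuous f.
  move=> v; apply: continuous_sum => i.
  apply: (@continuous_max _ _ (fun=> 0)); first exact: cst_continuous.
  exact: continuous_dotp.
pose S := [set v : 'rV[R]_n.+1 | `|v| = 1].
have S0 : S !=set0.
  pose e : 'rV[R]_n.+1 := delta_mx 0 0.
  have e0 : e != 0.
    by apply/eqP => /rowP/(_ 0); rewrite !mxE !eqxx => /eqP; rewrite oner_eq0.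
  by exists (`|e|^-1 *: e); rewrite /S /= normrZ normfV normr_id mulVf ?normr_eq0.
have cS : compact S.
  apply: bounded_closed_compact.
    exists 1; split=> // M M1 v /= ->; exact: ltW.
  rewrite (_ : S = (fun v : 'rV[R]_n.+1 => `|v|) @^-1` [set 1]); last by [].
  apply: preimage_closed; last exact: closed_eq.
  by move=> v _; exact: norm_continuous.
have [v0 v0S vmin] := EVT_min_rV S0 cS (continuous_subspaceT cf).
have fpos v : v != 0 -> 0 < f v.
  rewrite -oppr_eq0 => /span_pos[i vi].
  rewrite dotpNr oppr_lt0 dotpC in vi.
  rewrite /f (bigD1 i)//= ltr_pwDl//; first by rewrite lt_max vi orbT.
  by apply: sumr_ge0 => j _; rewrite le_max lexx.
have e0 : 0 < f v0.
  apply: fpos; apply/eqP => vE; move: v0S; rewrite inE /S /= vE normr0 => /eqP.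
  by rewrite eq_sym oner_eq0.
exists ((\sum_i `|h i|) / f v0) => x hx j.
have xj : `|x 0 j| <= `|x|.
  rewrite [leRHS]/Num.norm /= mx_normrE.
  exact: (le_bigmax _ (fun ij : 'I_1 * 'I_n.+1 => `|x ij.1 ij.2|) (0, j)).
apply: (le_trans xj); rewrite ler_pdivlMr//.
have [->|x0] := eqVneq x 0; first by rewrite normr0 mul0r sumr_ge0.
have nx : 0 < `|x| by rewrite normr_gt0.
have : f v0 <= f (`|x|^-1 *: x).
  by apply: vmin; rewrite inE /S /= normrZ normfV normr_id mulVf ?gt_eqF.
rewrite -(ler_pM2l nx) => /le_trans; apply.
rewrite /f mulr_sumr; apply: ler_sum => i _; rewrite dotpZl.
rewrite maxr_pMr ?(ltW nx)// mulr0 mulrA divff ?gt_eqF// mul1r.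
by rewrite ge_max normr_ge0 (le_trans (hx i))// ler_norm.
Qed.

Lemma vol_polyhedron_finite h : (vol n.+1 (polyhedron u h) < +oo)%E.
Proof.
have [c hc] := polyhedron_bounded h.
exact: (@vol_bounded _ _ _ c (measurable_polyhedron u h)).
Qed.

Lemma polyhedron_volE h : vol n.+1 (polyhedron u h) = (V h)%:E.
Proof. by rewrite fineK// ge0_fin_numE ?measure_ge0// vol_polyhedron_finite. Qed.

Lemma polyhedron_vol_gt0 h : (forall i, 0 < h i) -> 0 < V h.
Proof. by move=> h0; rewrite -lte_fin -polyhedron_volE; exact: vol_polyhedron_gt0. Qed.

Lemma polyhedron_vol_scale h c : 0 < c -> V (fun i => c * h i) = c ^+ n.+1 * V h.
Proof.
move=> c0; apply: EFin_inj; rewrite -polyhedron_volE vol_polyhedron_scale//.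
by rewrite polyhedron_volE.
Qed.

Lemma polyhedron_vol_translate h z : V (fun i => h i - dotp z (u i)) = V h.
Proof. by rewrite /polyhedron_vol vol_polyhedron_translate. Qed.

Lemma polyhedron_vol_le h h' : (forall i, h i <= h' i) -> V h <= V h'.
Proof.
move=> hh'; rewrite -lee_fin -!polyhedron_volE; apply: vol_le;
  [exact: measurable_polyhedron..|exact: polyhedron_sub].
Qed.

Lemma critical_scale h c : 0 < c -> critical h -> critical (fun i => c * h i).
Proof.
move=> c0; rewrite /critical => ch.
under eq_bigr do rewrite invfM mulrCA -scalerA.
by rewrite -scaler_sumr ch scaler0.
Qed.

Lemma energy_scale h c : 0 < c -> (forall i, 0 < h i) -> energy (fun i => c * h i) = energy h.
Proof.
move=> c0 h0; rewrite /energy polyhedron_vol_scale// lnM ?posrE ?exprn_gt0 ?polyhedron_vol_gt0//.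
under eq_bigr do rewrite lnM ?posrE// mulrDr.
rewrite big_split /= -mulr_suml -/total_mass lnXn// mulrDr opprD addrACA.
rewrite [X in X + _](_ : _ = 0) ?add0r// -[ln c *+ _]mulr_natl.
have : (n.+1%:R : R) != 0 by rewrite pnatr_eq0.
by move: (n.+1%:R : R) => d d0; field.
Qed.

(** By [critical_bound] the polyhedron lies in a parallelepiped for each basis, and
there are finitely many bases. *)
Lemma critical_vol_bound : exists2 K : R, 0 < K & forall h (f : 'I_n.+1 -> 'I_N),
  (forall i, 0 < h i) -> critical h -> \matrix_i u (f i) \in unitmx ->
  V h <= K * \prod_i h (f i).
Proof.
pose C := \sum_j total_mass / gam j.
have Cj j : 0 <= total_mass / gam j by rewrite divr_ge0 ?ltW ?total_mass_gt0.
have C0 : 0 <= C by exact: sumr_ge0.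
(* One constant for each choice of indices; the bound uses their sum. *)
pose K (f : {ffun 'I_n.+1 -> 'I_N}) :=
  `|\det (\matrix_i u (f i) : 'M[R]_n.+1)|^-1 * (C *+ 2) ^+ n.+1.
have K0 f : 0 <= K f by rewrite mulr_ge0 ?invr_ge0// exprn_ge0// mulrn_wge0.
exists (1 + \sum_f K f); first by rewrite ltr_pwDl// sumr_ge0.
move=> h f h0 ch uf.
have fE : (\matrix_i u ([ffun i => f i] i)) = \matrix_i u (f i).
  by apply/matrixP => i j; rewrite !mxE ffunE.
apply: (@le_trans _ _ (K [ffun i => f i] * \prod_i h (f i))); last first.
  rewrite ler_wpM2r//; first by apply: prodr_ge0 => i _; exact: ltW.
  by rewrite (bigD1 [ffun i => f i])//= addrCA lerDl addr_ge0// sumr_ge0.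
rewrite /K fE -lee_fin -polyhedron_volE.
have := @vol_basis_bound R n.+1 N u f (fun i => C * h (f i)) _ uf
  (measurable_polyhedron u h).
rewrite (_ : \prod_i (C * h (f i) *+ 2) = (C *+ 2) ^+ n.+1 * \prod_i h (f i)); last first.
  under eq_bigr do rewrite -mulrnAl.
  by rewrite big_split /= prodr_const card_ord.
rewrite mulrA; apply=> [i|x hx i]; first by rewrite mulr_ge0// ltW.
rewrite (le_trans (critical_bound _ h0 ch hx))// ler_wpM2r ?(ltW (h0 _))//.
by rewrite /C (bigD1 (f i))//= lerDl sumr_ge0.
Qed.

End log_minkowski_functional.

(** * A lower bound for the energy *)

Lemma ln_prod (R : realType) (I : Type) (r : seq I) (F : I -> R) :
  (forall i, 0 < F i) -> ln (\prod_(i <- r) F i) = \sum_(i <- r) ln (F i).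
Proof.
move=> F0; elim: r => [|i r IH]; first by rewrite !big_nil ln1.
by rewrite !big_cons lnM ?posrE ?prodr_gt0// IH.
Qed.

Section coercivity.
Context {R : realType} {n N : nat}.
Variables (u : 'I_N -> 'rV[R]_n.+1) (gam : 'I_N -> R).
Hypothesis gam0 : forall i, 0 < gam i.
Hypothesis u0 : forall i, u i != 0.
Hypothesis span_pos : forall v, v != 0 -> exists i, dotp (u i) v < 0.
Implicit Types (h : 'I_N -> R) (X : {vspace 'rV[R]_n.+1}) (I : {set 'I_N}).
Local Notation V := (polyhedron_vol u).
Local Notation total_mass := (total_mass gam).
Local Notation critical := (critical u gam).
Local Notation energy := (energy u gam).

Definition mass X := \sum_(i | u i \in X) gam i.

(** For a subspace of intermediate dimension this is the property of being essential. *)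
Definition spans_positively X := forall v, v \in X -> v != 0 ->
  exists2 i, u i \in X & dotp (u i) v < 0.

Definition subspace_concentration := forall X,
  (0 < \dim X < n.+1)%N -> spans_positively X ->
  mass X <= (\dim X)%:R / n.+1%:R * total_mass /\
  (mass X = (\dim X)%:R / n.+1%:R * total_mass -> exists X',
     [/\ (X + X')%VS = fullv, (X :&: X')%VS = 0%VS &
      mass X' = (\dim X')%:R / n.+1%:R * total_mass]).

Hypothesis conc : subspace_concentration.

(** The defect in the concentration inequality for the span of (u_i)_(i in I),
counting only the mass of I. *)
Definition excess I :=
  \sum_(i in I) gam i - total_mass / n.+1%:R * (\dim (span_of u I))%:R.

Definition gap (M : R) h I := forall i j, i \in I -> j \notin I -> M * h i < h j.

(** If v in the span has v . u_i >= 0 for all u_i in it, then v . u_i > 0 for some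
i in I.  Pairing v with the critical relation, this term of size 1 / h_i would
have to be compensated by terms outside I, which are L times smaller. *)
Lemma gap_spans_positively_ex I : exists2 L : R, 1 <= L & forall h,
  (forall i, 0 < h i) -> critical h -> I != finset.set0 -> gap L h I ->
  spans_positively (span_of u I).
Proof.
have [sp|/existsNP[v /not_implyP[vX /not_implyP[v0 hv]]]] :=
  pselect (spans_positively (span_of u I)); first by exists 1.
have pos i : u i \in span_of u I -> 0 <= dotp v (u i).
  by move=> iX; rewrite leNgt; apply/negP => lt; apply: hv; exists i; rewrite // dotpC.
have [i0 i0I ai0] : exists2 i, i \in I & 0 < dotp v (u i).
  apply: contrapT => hn; move/eqP: v0; apply; apply/eqP; rewrite -dotp_eq0; apply/eqP.
  apply: (dotp_span_of0 _ vX) => i iI; apply/eqP; rewrite dotpC eq_le pos ?mem_span_of// andbT.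
  by rewrite leNgt; apply/negP => lt; apply: hn; exists i.
(* The size of the positive term and of the compensating ones, both times h. *)
pose a := gam i0 * dotp v (u i0).
pose b := \sum_j gam j * `|dotp v (u j)|.
have a0 : 0 < a by rewrite mulr_gt0.
have b0 : 0 <= b by rewrite sumr_ge0// => j _; rewrite mulr_ge0// ltW.
have L1 : 1 <= 1 + b / a by rewrite lerDl divr_ge0// ltW.
exists (1 + b / a) => // h h0 ch _ hg; exfalso.
have L0 := lt_le_trans ltr01 L1.
have := critical_dotp v ch; rewrite (bigID (mem I)) /= => /eqP.
rewrite addr_eq0 => /eqP E.
have le1 : a / h i0 <= \sum_(i in I) gam i / h i * dotp v (u i).
  rewrite (bigD1 i0)//= /a mulrAC lerDl sumr_ge0// => i /andP[iI _].
  by rewrite mulr_ge0 ?pos ?mem_span_of ?divr_ge0 ?ltW.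
have le2 : - (\sum_(i in predC (mem I)) gam i / h i * dotp v (u i)) <=
    b / ((1 + b / a) * h i0).
  rewrite -sumrN /b mulr_suml [leRHS](bigID (mem I)) /= ler_wpDl//.
    by rewrite sumr_ge0// => i _; rewrite divr_ge0 ?mulr_ge0 ?(ltW (gam0 _)) ?(ltW (h0 _)) ?(ltW L0).
  apply: ler_sum => j jI; rewrite -mulrN mulrAC.
  apply: (@le_trans _ _ (gam j * `|dotp v (u j)| / h j)).
    by rewrite ler_pM2r ?invr_gt0// ler_pM2l// -normrN ler_norm.
  rewrite ler_wpM2l ?mulr_ge0 ?(ltW (gam0 _))// lef_pV2 ?posrE ?mulr_gt0//.
  by apply/ltW/hg.
have := le_trans le1 (eq_ind _ (fun z => z <= _) le2 _ (esym E)).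
rewrite invfM mulrA ler_pM2r ?invr_gt0// ler_pdivlMr// mulrDr mulr1 mulrCA divff ?gt_eqF// mulr1.
by rewrite gerDr leNgt a0.
Qed.

Lemma gap_spans_positively : exists2 L : R, 1 <= L & forall h I,
  (forall i, 0 < h i) -> critical h -> I != finset.set0 -> gap L h I ->
  spans_positively (span_of u I).
Proof.
have /choice[L hL] : forall I, exists L : R, 1 <= L /\ forall h,
  (forall i, 0 < h i) -> critical h -> I != finset.set0 -> gap L h I ->
  spans_positively (span_of u I).
  by move=> I; have [L] := gap_spans_positively_ex I; exists L.
exists (\sum_I L I).
  rewrite (bigD1 finset.set0)//= ler_wpDr ?(hL _).1// sumr_ge0// => I _.
  exact: le_trans ler01 (hL _).1.
move=> h I h0 ch I0 hg; apply: ((hL I).2 _ h0 ch I0) => i j iI jI.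
apply: le_lt_trans (hg i j iI jI); rewrite (ler_pM2r (h0 i)) (bigD1 I)//= lerDl sumr_ge0// => J _.
exact: le_trans ler01 (hL _).1.
Qed.

Lemma dim_span_of_gt0 I : I != finset.set0 -> (0 < \dim (span_of u I))%N.
Proof.
move=> /set0Pn[i iI]; rewrite lt0n dimv_eq0; apply/eqP => E.
have := mem_span_of u iI; rewrite E memv0; exact/negP/u0.
Qed.

Lemma dim_span_of_le I : (\dim (span_of u I) <= n.+1)%N.
Proof. by rewrite -[leqRHS](dim_rV R) dimvS ?subvf. Qed.

Lemma sum_le_mass I : \sum_(i in I) gam i <= mass (span_of u I).
Proof.
rewrite /mass [leRHS](bigID (mem I)) /=.
rewrite [X in X <= _](eq_bigl (fun i => (u i \in span_of u I) && (i \in I))).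
  by rewrite lerDl sumr_ge0// => i _; exact: ltW.
by move=> i; case: (boolP (i \in I)) => iI; rewrite ?andbF// mem_span_of.
Qed.

(** For a proper subspace this is the concentration inequality; for the whole space
it says that the mass of I is at most the total mass. *)
Lemma excess_le0 I : I != finset.set0 -> spans_positively (span_of u I) -> excess I <= 0.
Proof.
move=> I0 sp; rewrite subr_le0.
have [lt|] := ltnP (\dim (span_of u I)) n.+1.
  have dI : (0 < \dim (span_of u I) < n.+1)%N by rewrite dim_span_of_gt0.
  have [le _] := conc dI sp.
  by rewrite (le_trans (sum_le_mass I))// (le_trans le)// mulrC mulrA mulrAC.
move=> le; have -> : \dim (span_of u I) = n.+1 by apply/eqP; rewrite eqn_leq dim_span_of_le.
rewrite divfK ?pnatr_eq0// /total_mass [leRHS](bigID (mem I)) /= lerDl.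
by rewrite sumr_ge0// => i _; exact: ltW.
Qed.

Lemma excess_le_total I : excess I <= total_mass.
Proof.
rewrite /excess lerBlDr ler_wpDr//.
  by rewrite mulr_ge0 ?divr_ge0 ?(ltW (total_mass_gt0 gam0 span_pos)).
rewrite /total_mass [leRHS](bigID (mem I)) /= lerDl.
by rewrite sumr_ge0// => i _; exact: ltW.
Qed.

Lemma excess_setT : excess [set: 'I_N]%SET = 0.
Proof.
rewrite /excess (spans_full span_pos) dim_rV divfK ?pnatr_eq0// /total_mass.
by rewrite (eq_bigl predT) ?subrr// => i; rewrite inE.
Qed.

(** Estimate the volume with the greedy basis and sum by parts.  In the term k = N - 1
the index k.+1 is out of range and [nth] returns its default value, which does
not matter because the excess of the full set is 0. *)
Lemma energy_lower_bound : exists c : R, forall h (s : seq 'I_N) (i0 : 'I_N),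
  (forall i, 0 < h i) -> critical h -> uniq s -> size s = N ->
  - c + \sum_(k < N) excess (prefix_set s k.+1) *
     (ln (h (nth i0 s k)) - ln (h (nth i0 s k.+1))) <= energy h.
Proof.
have [K K0 hK] := critical_vol_bound gam0 span_pos.
exists (total_mass / n.+1%:R * ln K) => h s i0 h0 ch us sN.
have [fg sg] := greedy_span u i0 us sN (leqnn N).
pose b := greedy u i0 s N.
have bn : size b = n.+1.
  move: fg; rewrite /free sg prefix_setN// (spans_full span_pos) dim_rV size_map.
  by rewrite -/b => /eqP.
pose f (i : 'I_n.+1) := nth i0 b i.
have uf : \matrix_i u (f i) \in unitmx.
  rewrite (_ : \matrix_i _ = \matrix_i (map u b)`_i).
    by apply: free_unitmx => //; rewrite size_map.
  by apply/matrixP => i j; rewrite !mxE (nth_map i0) ?bn.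
have hf i : 0 < h (f i) by [].
have lnV : ln (V h) <= ln K + \sum_(i <- b) ln (h i).
  rewrite (big_nth i0) big_mkord bn -[\sum_(i < n.+1) _]/(\sum_i ln (h (f i))).
  rewrite -ln_prod// -lnM ?posrE ?prodr_gt0// ler_ln ?posrE ?mulr_gt0 ?prodr_gt0 ?(polyhedron_vol_gt0 span_pos)//.
  exact: hK.
pose w k := gam (nth i0 s k) -
  total_mass / n.+1%:R * (u (nth i0 s k) \notin span_of u (prefix_set s k))%:R.
have wE m : (m <= N)%N -> \sum_(k < m) w k = excess (prefix_set s m).
  move=> mN; rewrite /w sumrB -mulr_sumr /excess (sum_prefix i0 us)//.
  by rewrite (dim_prefix u i0 us).
have energyE : \sum_i gam i * ln (h i) - total_mass / n.+1%:R * \sum_(i <- b) ln (h i) =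
    \sum_(k < N) excess (prefix_set s k.+1) *
     (ln (h (nth i0 s k)) - ln (h (nth i0 s k.+1))).
  transitivity (\sum_(k < N) w k * ln (h (nth i0 s k))).
    rewrite (sum_greedy u i0) mulr_sumr.
    have -> : \sum_i gam i * ln (h i) = \sum_(i in prefix_set s N) gam i * ln (h i).
      by apply: eq_bigl => i; rewrite prefix_setN// inE.
    rewrite (sum_prefix i0 us)// -sumrB; apply: eq_bigr => k _.
    by rewrite /w mulrBl mulrA.
  rewrite (abel_summation w (fun k => ln (h (nth i0 s k)))) wE// prefix_setN//.
  by rewrite excess_setT mul0r add0r; apply: eq_bigr => k _; rewrite wE.
rewrite /energy -energyE.
have Td : 0 <= total_mass / n.+1%:R.
  by rewrite divr_ge0// (ltW (total_mass_gt0 gam0 span_pos)).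
have := ler_wpM2l Td lnV; rewrite mulrDr.
move: (_ * ln (V h)) (_ * ln K) (_ * \sum_(i <- b) _) (\sum_i _) => x y z t xyz.
by lra.
Qed.

End coercivity.

(** * Large gaps *)

Section big_gaps.
Context {R : realType} {n N : nat}.
Variables (u : 'I_N -> 'rV[R]_n.+1) (gam : 'I_N -> R).
Hypothesis gam0 : forall i, 0 < gam i.
Hypothesis u0 : forall i, u i != 0.
Hypothesis span_pos : forall v, v != 0 -> exists i, dotp (u i) v < 0.
Implicit Types (h : 'I_N -> R) (I : {set 'I_N}).
Local Notation T := (total_mass gam).
Local Notation critical := (critical u gam).
Local Notation energy := (energy u gam).
Local Notation excess := (excess u gam).
Local Notation spans_positively := (spans_positively u).
Hypothesis conc : subspace_concentration u gam.

Lemma gap_le (L M : R) h I : (forall i, 0 < h i) -> L <= M -> gap M h I -> gap L h I.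
Proof.
by move=> h0 LM g i j iI jI; apply: le_lt_trans (g i j iI jI); rewrite (ler_pM2r (h0 i)).
Qed.

Lemma exists_sorted_enum h : exists s : seq 'I_N, [/\ uniq s, size s = N &
  forall i0 j k, (j <= k)%N -> (k < N)%N -> h (nth i0 s j) <= h (nth i0 s k)].
Proof.
pose le := [rel i j : 'I_N | h i <= h j].
have tot : ssrbool.total le by move=> i j; exact: le_total.
have tr : transitive le by move=> i j k; exact: le_trans.
exists (sort le (enum 'I_N)); split.
- by rewrite sort_uniq enum_uniq.
- by rewrite size_sort size_enum_ord.
move=> i0 j k jk kN; have sz : size (sort le (enum 'I_N)) = N by rewrite size_sort size_enum_ord.
apply: (sorted_leq_nth tr (fun x => lexx (h x)) i0 (sort_sorted tot _)) => //.
  by rewrite inE sz (leq_ltn_trans jk).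
by rewrite inE sz.
Qed.

(** A set of indices with a gap above it consists of the first entries of any
increasing enumeration. *)
Lemma gap_prefix (M : R) h I (s : seq 'I_N) (i0 : 'I_N) :
  (forall i, 0 < h i) -> 1 <= M -> uniq s -> size s = N ->
  (forall j k, (j <= k)%N -> (k < N)%N -> h (nth i0 s j) <= h (nth i0 s k)) ->
  I != finset.set0 -> I != [set: 'I_N]%SET -> gap M h I ->
  exists k, [/\ (k.+1 < N)%N, I = prefix_set s k.+1, nth i0 s k \in I &
    nth i0 s k.+1 \notin I].
Proof.
move=> h0 M1 us sN ms I0 IT g.
(* The first entry outside I. *)
pose k := find (fun i => i \notin I) s.
have kN : (k < N)%N.
  rewrite -sN -has_find; apply/hasP.
  have [i iI] : exists i, i \notin I.
    apply: contrapT => nI; case/eqP: IT; apply/setP => i; rewrite inE.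
    by apply/negPn/negP => iI; apply: nI; exists i.
  by exists i => //; exact: (mem_full_uniq us sN).
have kI : nth i0 s k \notin I.
  by apply: (@nth_find _ i0 (fun i => i \notin I)); rewrite has_find sN.
have ltk j : (j < k)%N -> nth i0 s j \in I.
  by move=> jk; have := before_find i0 jk => /negbT/negPn.
have gek j : (k <= j)%N -> (j < N)%N -> nth i0 s j \notin I.
  move=> kj jN; apply/negP => jI; have := g _ _ jI kI; rewrite ltNge => /negP; apply.
  by rewrite (le_trans (ms _ _ kj jN))// ler_peMl// ltW.
have IE : I = prefix_set s k.
  apply/setP => i; rewrite inE; apply/idP/idP => [iI|/(nthP i0)[j]].
    have /(nthP i0)[j js ji] := mem_full_uniq us sN i.
    have jk : (j < k)%N.
      rewrite ltnNge; apply/negP => kj; have jN : (j < N)%N by rewrite -sN.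
      by move: (gek _ kj jN); rewrite ji iI.
    by apply/(nthP i0); exists j; rewrite ?size_takel ?sN ?(ltnW kN)// nth_take.
  rewrite size_takel ?sN ?(ltnW kN)// => jk; rewrite nth_take// => <-; exact: ltk.
case: k => [|k] in kN kI ltk gek IE *.
  by move: I0; rewrite IE prefix_set0 eqxx.
by exists k; split=> //; exact: ltk.
Qed.

(** In [energy_lower_bound] every term is at least - Gamma ln L, where L is the
constant of [gap_spans_positively]: below this ratio because the excess is at
most Gamma, above it because the excess is nonpositive.  A gap of ratio M with
negative excess contributes at least e ln M, which for large M contradicts the
bound on the energy. *)
Lemma big_gap_balanced (E0 : R) : exists2 M : R, 1 <= M & forall h I,
  (forall i, 0 < h i) -> critical h -> energy h <= E0 ->
  I != finset.set0 -> I != [set: 'I_N]%SET -> gap M h I ->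
  spans_positively (span_of u I) /\ excess I = 0.
Proof.
have [L L1 hL] := gap_spans_positively u gam0.
have [c hc] := energy_lower_bound gam0 span_pos.
have T0 := total_mass_gt0 gam0 span_pos.
have lnL0 : 0 <= ln L by exact: ln_ge0.
pose c1 := c + N%:R * (T * ln L).
pose e := \big[Num.min/1]_(I | excess I < 0) (- excess I).
have e0 : 0 < e by apply: lt_bigmin => // I; rewrite oppr_gt0.
(* Chosen so that e * ln M > E0 + c1. *)
pose M0 := (`|E0 + c1| + 1) / e.
exists (Num.max L (expR M0)); first by rewrite le_max L1.
set M := Num.max _ _ => h I h0 ch hE I0 IT g.
have LM : L <= M by rewrite le_max lexx.
have M1 := le_trans L1 LM.
have sp := hL h I h0 ch I0 (gap_le h0 LM g).
split=> //; apply/eqP; rewrite eq_le (excess_le0 gam0 u0 conc I0 sp) /= leNgt.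
apply/negP => eI.
have [i0 _] := inhabited_index span_pos.
have [s [us sN ms]] := exists_sorted_enum h.
have [k [kN IE kI kI']] := gap_prefix h0 M1 us sN (ms i0) I0 IT g.
pose t j := excess (prefix_set s j.+1) * (ln (h (nth i0 s j)) - ln (h (nth i0 s j.+1))).
(* The general lower bound for one term of the sum. *)
have t_ge j : (j < N)%N -> - (T * ln L) <= t j.
  move=> jN; have [jN'|] := ltnP j.+1 N; last first.
    move=> Nj; have -> : t j = 0.
      have jE : j.+1 = N by apply/eqP; rewrite eqn_leq jN.
      by rewrite /t jE (prefix_setN us sN) (excess_setT gam span_pos) mul0r.
    by rewrite oppr_le0 mulr_ge0 ?(ltW T0).
  have mono := ms i0 _ _ (leqnSn j) jN'.
  have d0 : ln (h (nth i0 s j)) <= ln (h (nth i0 s j.+1)) by rewrite ler_ln ?posrE.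
  rewrite /t -[_ - ln _]opprB mulrN lerN2.
  set d := _ - _; have {}d0 : 0 <= d by rewrite subr_ge0.
  have [dL|Ld] := leP d (ln L).
    rewrite (le_trans (ler_wpM2r d0 (excess_le_total gam0 span_pos _)))//.
    by rewrite (ler_pM2l T0).
  apply: (@le_trans _ _ 0); last by rewrite mulr_ge0 ?(ltW T0).
  rewrite mulr_le0_ge0//.
  have P0 : prefix_set s j.+1 != finset.set0.
    by apply/set0Pn; exists (nth i0 s j); rewrite (prefix_setS i0 sN)// !inE eqxx.
  apply: (excess_le0 gam0 u0 conc P0); apply: (hL h _ h0 ch P0) => a b.
  rewrite !inE => aP bP.
  have {aP} le_a : h a <= h (nth i0 s j).
    move: aP => /(nthP i0)[p]; rewrite size_takel ?sN// => pj; rewrite nth_take// => <-.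
    exact: ms.
  have le_b : h (nth i0 s j.+1) <= h b.
    have /(nthP i0)[q qs qb] := mem_full_uniq us sN b.
    rewrite -qb; apply: ms; last by rewrite -sN.
    rewrite ltnNge; apply/negP => qj; move/negP: bP; apply.
    by apply/(nthP i0); exists q; rewrite ?size_takel ?sN// nth_take.
  apply: lt_le_trans le_b; apply: (@le_lt_trans _ _ (L * h (nth i0 s j))).
    by rewrite ler_wpM2l// (le_trans ler01).
  have L0 := lt_le_trans ltr01 L1.
  by rewrite -ltr_ln ?posrE ?mulr_gt0// lnM ?posrE// -ltrBrDr.
(* The better bound for the term of the gap I. *)
have tk : e * ln M <= t k.
  rewrite /t -IE -[ln _ - _]opprB mulrN -mulNr.
  have lnM0 : 0 <= ln M by exact: ln_ge0.
  apply: ler_pM => //; first exact: ltW.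
    by rewrite /e; exact: bigmin_le_cond.
  have M0' := lt_le_trans ltr01 M1.
  rewrite lerBrDr -lnM ?posrE// ler_ln ?posrE ?mulr_gt0//.
  exact/ltW/g.
have := hc h s i0 h0 ch us sN.
have kN' := ltnW kN.
rewrite (bigD1 (Ordinal kN'))//= -/(t k).
set S := \sum_(i < N | _) _.
have S_ge : - (N%:R * (T * ln L)) <= S.
  rewrite (@le_trans _ _ (\sum_(i < N | i != Ordinal kN') - (T * ln L)))//; last first.
    by apply: ler_sum => i _; exact: t_ge.
  rewrite sumrN lerN2 sumr_const -[_ *+ _]mulr_natl ler_wpM2r ?mulr_ge0 ?(ltW T0)//.
  by rewrite ler_nat (leq_trans (max_card _))// card_ord.
have : `|E0 + c1| + 1 <= e * ln M.
  rewrite mulrC -ler_pdivrMr// -[leLHS]expRK ler_ln ?posrE ?expR_gt0//.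
    by rewrite /M /M0 le_max lexx orbT.
  exact: lt_le_trans ltr01 M1.
have := ler_norm (E0 + c1); rewrite /c1; move: (N%:R * _) (e * _) S_ge tk hE.
by move=> x y; lra.
Qed.

End big_gaps.

(** * The equality case: independent rescaling *)

(** The map that multiplies by c on X and is the identity on X'.  It is conjugate to
a diagonal matrix by the matrix of a basis adapted to the decomposition. *)
Lemma linear_scaling_matrix (R : realType) (n : nat) (X X' : {vspace 'rV[R]_n}) (c : R) :
  (X + X')%VS = fullv -> (X :&: X')%VS = 0%VS ->
  exists A : 'M[R]_n, [/\ \det A = c ^+ \dim X,
    (forall v, v \in X -> v *m A = c *: v) & (forall v, v \in X' -> v *m A = v)].
Proof.
move=> XXT XX0.
pose b := vbasis X ++ vbasis X'.
have sb : size b = n.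
  by rewrite size_cat !size_tuple -dimv_disjoint_sum// XXT dim_rV.
have fb : free b.
  rewrite cat_free !(basis_free (vbasisP _)) !(span_basis (vbasisP _)) /=.
  by rewrite directv_addE /= !directvE /= !eqxx /= XX0 eqxx.
have uW := free_unitmx fb sb; set W := \matrix_i _ in uW.
pose dd (i : 'I_n) := if (i < \dim X)%N then c else 1.
pose D : 'M[R]_n := diag_mx (\row_i dd i).
have WA : W *m (invmx W *m D *m W) = D *m W by rewrite !mulmxA mulmxV// mul1mx.
have bA i : (i < n)%N -> b`_i *m (invmx W *m D *m W) = (if (i < \dim X)%N then c else 1) *: b`_i.
  move=> ni; have := congr1 (row (Ordinal ni)) WA.
  by rewrite !row_mul row_diag_mx -scalemxAl -!rowE !rowK !mxE.
exists (invmx W *m D *m W); split.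
- rewrite !det_mulmx mulrAC -det_mulmx mulVmx// det1 mul1r det_diag.
  under eq_bigr do rewrite mxE.
  rewrite /dd -big_mkcond /= -(big_ord_widen _ (fun=> c)) ?prodr_const ?card_ord//.
  by rewrite -[leqRHS](dim_rV R) dimvS ?subvf.
- move=> v vX; rewrite (coord_vbasis vX) mulmx_suml scaler_sumr; apply: eq_bigr => i _.
  have iX : (i < size (vbasis X))%N by rewrite size_tuple.
  have := bA i; rewrite -scalemxAl /b nth_cat iX ltn_ord => -> //.
    by rewrite !scalerA mulrC.
  by rewrite (leq_trans (ltn_ord i))// -[leqRHS](dim_rV R) dimvS ?subvf.
- move=> v vX; rewrite (coord_vbasis vX) mulmx_suml; apply: eq_bigr => i _.
  rewrite -scalemxAl; congr (_ *: _).
  have nlt : (\dim X + i < \dim X)%N = false by rewrite ltnNge leq_addr.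
  have := bA (\dim X + i)%N; rewrite /b nth_cat size_tuple nlt addKn scale1r; apply.
  by apply: leq_trans (eq_leq sb); rewrite size_cat !size_tuple ltn_add2l.
Qed.

Section rescaling.
Context {R : realType} {n N : nat}.
Variables (u : 'I_N -> 'rV[R]_n.+1) (gam : 'I_N -> R).
Hypothesis gam0 : forall i, 0 < gam i.
Hypothesis u0 : forall i, u i != 0.
Hypothesis span_pos : forall v, v != 0 -> exists i, dotp (u i) v < 0.
Implicit Types (h : 'I_N -> R) (I : {set 'I_N}).
Local Notation V := (polyhedron_vol u).
Local Notation T := (total_mass gam).
Local Notation critical := (critical u gam).
Local Notation energy := (energy u gam).
Local Notation excess := (excess u gam).
Local Notation mass := (mass u gam).
Local Notation spans_positively := (spans_positively u).
Hypothesis conc : subspace_concentration u gam.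

Definition rescale (c : R) I h i := if i \in I then c * h i else h i.

(** Zero excess puts the span X of I in the equality case of the concentration
condition, with no atom of X outside I.  The masses of X and of its complement
then add up to the total mass, so that no atom is left outside their union. *)
Lemma balanced_splits I : I != finset.set0 -> I != [set: 'I_N]%SET ->
  spans_positively (span_of u I) -> excess I = 0 ->
  exists X', [/\ (span_of u I + X')%VS = fullv, (span_of u I :&: X')%VS = 0%VS &
    forall i, i \notin I -> u i \in X'].
Proof.
move=> I0 IT sp ex0; set X := span_of u I.
have T0 := total_mass_gt0 gam0 span_pos.
have [j jI] : exists j, j \notin I.
  apply: contrapT => nI; case/eqP: IT; apply/setP => i; rewrite inE.
  by apply/negPn/negP => iI; apply: nI; exists i.
have gI : \sum_(i in I) gam i = (\dim X)%:R / n.+1%:R * T.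
  by move/eqP: ex0; rewrite subr_eq0 => /eqP ->; rewrite -/X mulrC mulrA mulrAC.
have dX : (0 < \dim X < n.+1)%N.
  rewrite dim_span_of_gt0//= ltn_neqAle dim_span_of_le andbT; apply/eqP => dE.
  have : \sum_(i in I) gam i < T.
    rewrite /total_mass [ltRHS](bigID (mem I)) /= ltrDl (bigD1 j)//=.
    by rewrite ltr_pwDl// sumr_ge0// => i _; exact: ltW.
  by rewrite gI dE divff ?pnatr_eq0// mul1r ltxx.
have [le eqX] := conc dX sp.
have mX : mass X = (\dim X)%:R / n.+1%:R * T.
  by apply/eqP; rewrite eq_le le /= -gI; exact: sum_le_mass.
have [X' [XT X0 mX']] := eqX mX; exists X'; split => // i iI.
have uX : u i \notin X.
  apply/negP => uX; have : \sum_(i in I) gam i < mass X.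
    rewrite /mass [ltRHS](bigID (mem I)) /= [X in _ < X + _](eq_bigl (fun k => k \in I)); last first.
      by move=> k; case: (boolP (k \in I)) => kI; rewrite ?andbF// mem_span_of.
    rewrite ltrDl (bigD1 i) ?uX//= ltr_pwDl// sumr_ge0// => k _; exact: ltW.
  by rewrite mX gI ltxx.
apply/negPn/negP => uX'.
have dXX' : (\dim X + \dim X' = n.+1)%N by rewrite -dimv_disjoint_sum// XT dim_rV.
have : mass X + mass X' = T.
  by rewrite mX mX' -mulrDl -mulrDl -natrD dXX' divff ?pnatr_eq0// mul1r.
apply/eqP; rewrite lt_eqF//.
have disj k : u k \in X -> u k \notin X'.
  move=> kX; apply/negP => kX'; case/negP: (u0 k).
  by rewrite -memv0 -X0 memv_cap kX.
rewrite /mass /total_mass [ltRHS](bigID (fun k => u k \in X)) /= ltrD2l.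
rewrite [ltRHS](bigID (fun k => u k \in X')) /= (eq_bigl (fun k => (u k \notin X) && (u k \in X'))).
  rewrite ltrDl (bigD1 i) ?uX ?uX'//= ltr_pwDl// sumr_ge0// => k _; exact: ltW.
move=> k; case: (boolP (u k \in X)) => //= kX; exact/negbTE/disj.
Qed.

Lemma rescale_gt0 c I h : 0 < c -> (forall i, 0 < h i) -> forall i, 0 < rescale c I h i.
Proof. by move=> c0 h0 i; rewrite /rescale; case: ifP => // _; rewrite mulr_gt0. Qed.

(** The critical relation splits into its components in X and in X', both of which
vanish, so it survives the rescaling.  The polyhedron is transformed by a linear
map of determinant c ^ (dim X), and the energy changes by excess I * ln c = 0. *)
Lemma rescale_balanced c I h : 0 < c -> (forall i, 0 < h i) -> critical h ->
  I != finset.set0 -> I != [set: 'I_N]%SET ->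
  spans_positively (span_of u I) -> excess I = 0 ->
  critical (rescale c I h) /\ energy (rescale c I h) = energy h.
Proof.
move=> c0 h0 ch I0 IT sp ex0.
have [X' [XT X0 uX']] := balanced_splits I0 IT sp ex0.
split.
  pose S := \sum_(i in I) (gam i / h i) *: u i.
  pose S' := \sum_(i | i \notin I) (gam i / h i) *: u i.
  have SS : S + S' = 0 by rewrite -ch [RHS](bigID (mem I)).
  have SX : S \in span_of u I by apply: memv_suml => i iI; rewrite memvZ// mem_span_of.
  have SX' : S' \in X' by apply: memv_suml => i iI; rewrite memvZ// uX'.
  have S0 : S = 0.
    apply/eqP; rewrite -memv0 -X0 memv_cap SX /=.
    by move/eqP: SS; rewrite addr_eq0 => /eqP ->; rewrite memvN.
  have S'0 : S' = 0 by rewrite -SS S0 add0r.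
  rewrite /critical (bigID (mem I)) /=.
  rewrite (eq_bigr (fun i => c^-1 *: ((gam i / h i) *: u i))) => [|i iI]; last first.
    by rewrite /rescale iI scalerA invfM mulrCA.
  rewrite -scaler_sumr -/S S0 scaler0 add0r -[RHS]S'0; apply: eq_bigr => i iI.
  by rewrite /rescale (negPf iI).
have VE : V (rescale c I h) = c ^+ \dim (span_of u I) * V h.
  have [A [dA AX AX']] := linear_scaling_matrix c^-1 XT X0.
  have uA : A^T \in unitmx.
    by rewrite unitmx_tr unitmxE dA unitfE expf_neq0// invr_eq0 gt_eqF.
  apply: EFin_inj; rewrite -(polyhedron_volE span_pos) EFinM -(polyhedron_volE span_pos).
  rewrite (vol_linear uA (measurable_polyhedron u h)) det_tr dA gtr0_norm ?exprn_gt0 ?invr_gt0//.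
  rewrite muleA -EFinM -exprMn divff ?gt_eqF// expr1n mul1e; congr (vol _ _).
  apply/seteqP; split => x hx i; have := hx i; rewrite /rescale dotp_mulmxl trmxK;
    case: ifPn => iI.
  - by rewrite AX ?mem_span_of// dotpZr ler_pdivrMl.
  - by rewrite AX' ?uX'.
  - by rewrite AX ?mem_span_of// dotpZr ler_pdivrMl.
  - by rewrite AX' ?uX'.
rewrite /energy VE lnM ?posrE ?exprn_gt0 ?(polyhedron_vol_gt0 span_pos)// lnXn// mulrDr.
have -> : \sum_i gam i * ln (rescale c I h i) =
    \sum_(i in I) gam i * ln c + \sum_i gam i * ln (h i).
  rewrite [X in _ = _ + X](bigID (mem I)) /= addrA -big_split /= [LHS](bigID (mem I)) /=.
  congr (_ + _); apply: eq_bigr => i iI; rewrite /rescale ?iI ?(negPf iI)//.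
  by rewrite lnM ?posrE// mulrDr.
rewrite -mulr_suml; move: ex0; rewrite /excess => /eqP; rewrite subr_eq0 => /eqP ->.
by rewrite -[ln c *+ _]mulr_natr; ring.
Qed.

End rescaling.

(** * Existence of a minimiser *)

Section minimiser.
Context {R : realType} {n N : nat}.
Variables (u : 'I_N -> 'rV[R]_n.+1) (gam : 'I_N -> R).
Hypothesis gam0 : forall i, 0 < gam i.
Hypothesis u0 : forall i, u i != 0.
Hypothesis span_pos : forall v, v != 0 -> exists i, dotp (u i) v < 0.
Implicit Types (h : 'I_N -> R) (I : {set 'I_N}).
Local Notation V := (polyhedron_vol u).
Local Notation critical := (critical u gam).
Local Notation energy := (energy u gam).
Hypothesis conc : subspace_concentration u gam.

Definition gap_sets (M : R) h : {set {set 'I_N}} :=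
  [set I : {set 'I_N} | [&& I != finset.set0, I != [set: 'I_N]%SET & `[< gap M h I >]]]%SET.

(** The sublevel sets {j | h_j <= M^k h_i} grow strictly with k until they contain
all N indices, because none of them has a gap above it. *)
Lemma no_gap_ratio (M : R) h : 1 <= M -> (forall i, 0 < h i) ->
  gap_sets M h = finset.set0 -> forall i j, h j <= M ^+ N * h i.
Proof.
move=> M1 h0 G0 i.
have M0 := lt_le_trans ltr01 M1.
pose I_ k : {set 'I_N} := [set j | h j <= M ^+ k * h i]%SET.
suff : I_ N = [set: 'I_N]%SET.
  by move=> E j; have jI : j \in I_ N; [rewrite E inE|move: jI; rewrite inE].
suff : forall k, (k < #|I_ k|)%N \/ I_ k = [set: 'I_N]%SET.
  move=> /(_ N) [|//]; have := max_card (mem (I_ N)); rewrite card_ord => le.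
  by rewrite ltnNge le.
have sub k : I_ k \subset I_ k.+1.
  apply/fintype.subsetP => j; rewrite !inE => /le_trans; apply.
  by rewrite exprS -mulrA ler_peMl// mulr_ge0 ?exprn_ge0// ltW.
elim=> [|k [IH|IH]].
- by left; rewrite card_gt0; apply/set0Pn; exists i; rewrite inE mul1r.
- have [IT|IT] := eqVneq (I_ k) [set: 'I_N]%SET.
    by right; apply/eqP; rewrite finset.eqEsubset finset.subsetT -IT sub.
  left; apply: (leq_ltn_trans IH); apply: proper_card; apply/properP; split=> //.
  have I0 : I_ k != finset.set0 by rewrite -card_gt0 (leq_ltn_trans _ IH).
  have : ~ gap M h (I_ k).
    move=> g; suff : I_ k \in gap_sets M h by rewrite G0 inE.
    by rewrite inE I0 IT; apply/asboolP.
  rewrite /gap => /existsNP[a /existsNP[b /not_implyP[aI]]].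
  move=> /not_implyP[bI /negP]; rewrite -leNgt => hb.
  exists b => //; rewrite inE (le_trans hb)// exprS -mulrA ler_pM2l//.
  by rewrite inE in aI.
- by right; apply/eqP; rewrite finset.eqEsubset finset.subsetT -IH sub.
Qed.

Lemma finset_argmax h I : I != finset.set0 ->
  exists2 i, i \in I & forall j, j \in I -> h j <= h i.
Proof.
move=> /set0Pn[i0 i0I].
have [i iI hi] := @arg_maxP _ _ _ i0 (mem I) h i0I.
by exists i.
Qed.

(** Induction on the number of sets with a gap.  If I is one of them then it is
balanced, and rescaling it until its largest coordinate meets the smallest one
outside I destroys this gap and creates no other. *)
Lemma close_gaps (E0 : R) : exists2 M : R, 1 <= M & forall h,
  (forall i, 0 < h i) -> critical h -> energy h <= E0 ->
  exists h', [/\ (forall i, 0 < h' i), critical h', energy h' = energy h &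
    gap_sets M h' = finset.set0].
Proof.
have [M M1 hM] := big_gap_balanced gam0 u0 span_pos conc E0.
have M0 := lt_le_trans ltr01 M1.
exists M => // h; have [k] := ubnP #|gap_sets M h|; elim: k h => // k IH h kG h0 ch hP.
have [G0|/set0Pn[I]] := eqVneq (gap_sets M h) finset.set0; first by exists h.
move=> IG; have := IG; rewrite inE => /and3P[I0 IT /asboolP g].
have [sp ex0] := hM h I h0 ch hP I0 IT g.
have [a aI amax] := finset_argmax h I0.
have IC0 : ~: I != finset.set0.
  by apply: contra IT => /eqP E; rewrite -[I]finset.setCK E finset.setC0.
have [b bI bmin] := finset_argmax (fun i => - h i) IC0.
rewrite inE in bI.
(* The factor that brings the largest coordinate in I to the smallest outside. *)
pose c := h b / h a.
have cM : M < c by rewrite ltr_pdivlMr//; exact: g.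
have c0 : 0 < c := lt_trans M0 cM.
have c1 : 1 <= c := ltW (le_lt_trans M1 cM).
have [ch' Ph'] := rescale_balanced gam0 u0 span_pos conc c0 h0 ch I0 IT sp ex0.
have h'0 := rescale_gt0 I c0 h0.
set h' := rescale c I h in ch' Ph' h'0.
have hh' i : h i <= h' i.
  by rewrite /h' /rescale; case: ifP => // _; rewrite ler_peMl// ltW.
have I_le i j : i \in I -> j \notin I -> h' i <= h' j.
  move=> iI jI; rewrite /h' /rescale iI (negPf jI).
  apply: (@le_trans _ _ (h b)); last by rewrite -lerN2 bmin// inE.
  by rewrite /c mulrAC ler_pdivrMr// ler_pM2l// amax.
have sub : gap_sets M h' \subset gap_sets M h :\ I.
  apply/fintype.subsetP => J; rewrite !inE => /and3P[J0 JT /asboolP gJ].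
  apply/andP; split.
    apply/eqP => JI; have := gJ a b; rewrite JI => /(_ aI bI).
    rewrite /h' /rescale aI (negPf bI) /c divfK ?gt_eqF// ltNge => /negP; apply.
    by rewrite ler_peMl// ltW.
  rewrite J0 JT /=; apply/asboolP => i j iJ jJ.
  have lt := gJ i j iJ jJ.
  have [jI|jI] := boolP (j \in I); last first.
    apply: (@le_lt_trans _ _ (M * h' i)); first by rewrite ler_pM2l.
    by move: lt; rewrite {2}/h' /rescale (negPf jI).
  have [iI|iI] := boolP (i \in I).
    by move: lt; rewrite /h' /rescale jI iI mulrCA ltr_pM2l.
  have := le_lt_trans (ler_wpM2l (ltW M0) (I_le j i jI iI)) lt.
  by rewrite ltNge ler_peMl// ltW.
have [h'' [h''0 ch'' Ph'' G'']] : exists h'', [/\ (forall i, 0 < h'' i), critical h'', energy h'' = energy h' &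
    gap_sets M h'' = finset.set0].
  apply: IH => //; last by rewrite Ph'.
  apply: leq_ltn_trans (subset_leq_card sub) _.
  by move: kG; rewrite (cardsD1 I) IG.
by exists h''; split=> //; rewrite Ph''.
Qed.

(** If h' is between (1 - d) h and (1 + d) h then so is the polyhedron, and its volume
is between (1 - d)^(n+1) and (1 + d)^(n+1) times that of h. *)
Lemma continuous_polyhedron_vol h : (forall i, 0 < h i) -> forall e, 0 < e ->
  exists2 d : R, 0 < d & forall h', (forall i, `|h' i - h i| <= d * h i) ->
    `|V h' - V h| < e.
Proof.
move=> h0 e e0; have V0 := polyhedron_vol_gt0 span_pos h0.
have cf : {for 1, continuous (fun c : R => c ^+ n.+1 * V h)}.
  by apply: continuousM; [exact: exprn_continuous|exact: cst_continuous].
have /cvgrPdist_lt/(_ e e0)/nbhs_ballP[d /= d0 hd] := cf.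
have d2 : 0 < Num.min (d / 2) (1 / 2) by rewrite lt_min !divr_gt0.
exists (Num.min (d / 2) (1 / 2)) => //; set d' := Num.min _ _ in d2 *.
have dd' : d' < d by rewrite (@le_lt_trans _ _ (d / 2))// ?ge_min ?lexx// ltr_pdivrMr// ltr_pMr// ltr1n.
have d'1 : d' < 1 by rewrite (@le_lt_trans _ _ (1 / 2))// ?ge_min ?lexx ?orbT// ltr_pdivrMr// mul1r ltr1n.
move=> h' hh'.
have lo : `|V h - (1 - d') ^+ n.+1 * V h| < e.
  rewrite -[X in `|X - _|](mul1r) -[X in X * _](expr1n _ n.+1); apply: hd.
  by rewrite /ball /= opprB addrC subrK gtr0_norm.
have hi : `|V h - (1 + d') ^+ n.+1 * V h| < e.
  rewrite -[X in `|X - _|](mul1r) -[X in X * _](expr1n _ n.+1); apply: hd.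
  by rewrite /ball /= opprD addrA subrr sub0r normrN gtr0_norm.
have le1 : (1 - d') ^+ n.+1 * V h <= V h'.
  rewrite -(polyhedron_vol_scale span_pos) ?subr_gt0//; apply: (polyhedron_vol_le span_pos) => i.
  by have := hh' i; rewrite ler_norml => /andP[]; rewrite mulrBl mul1r; lra.
have le2 : V h' <= (1 + d') ^+ n.+1 * V h.
  rewrite -(polyhedron_vol_scale span_pos) ?addr_gt0//; apply: (polyhedron_vol_le span_pos) => i.
  by have := hh' i; rewrite ler_norml => /andP[]; rewrite mulrDl mul1r; lra.
move: lo hi le1 le2; rewrite !ltr_norml => /andP[? ?] /andP[? ?] ? ?.
by apply/andP; split; lra.
Qed.

(** In terms of the reciprocals of the h_i; see [exists_minimiser]. *)
Lemma continuous_energy (a : 'rV[R]_N) : (forall i, 0 < a 0 i) ->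
  {for a, continuous (fun x : 'rV[R]_N => energy (fun i => (x 0 i)^-1))}.
Proof.
move=> a0.
have ai0 i : 0 < (a 0 i)^-1 by rewrite invr_gt0.
have cinv i : {for a, continuous (fun x : 'rV[R]_N => (x 0 i)^-1)}.
  apply: (@continuousV _ _ (fun x : 'rV[R]_N => x 0 i)); first by rewrite gt_eqF.
  exact: coord_continuous.
apply: continuousB.
  apply: continuous_sum => i; apply: continuousM; first exact: cst_continuous.
  apply: (@continuous_comp _ _ _ (fun x : 'rV[R]_N => (x 0 i)^-1) (@ln R)); first exact: cinv.
  exact: continuous_ln.
apply: continuousM; first exact: cst_continuous.
apply: (@continuous_comp _ _ _ (fun x : 'rV[R]_N => V (fun i => (x 0 i)^-1)) (@ln R)); last first.
  by apply: continuous_ln; exact: (polyhedron_vol_gt0 span_pos).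
apply/(@cvgrPdist_lt _ _ _ _ (nbhs_filter a)) => e e0.
have [d d0 hd] := continuous_polyhedron_vol ai0 e0.
have : nbhs a [set x : 'rV[R]_N | forall i, `|(a 0 i)^-1 - (x 0 i)^-1| < d * (a 0 i)^-1].
  apply: (@filter_forall _ _ _ _ (nbhs_filter a)) => i.
  have /(@cvgrPdist_lt _ _ _ _ (nbhs_filter a)) := cinv i.
  by apply; rewrite mulr_gt0.
apply: (@filterS _ _ (nbhs_filter a)) => x hx; rewrite distrC; apply: hd => i.
by rewrite distrC ltW.
Qed.

(** By [close_gaps] and scaling it suffices to consider h with 1 <= h_i <= C.  In
terms of the reciprocals a_i = 1 / h_i the critical relation is linear, so these
h correspond to a compact set. *)
Lemma exists_minimiser h1 : (forall i, 0 < h1 i) -> critical h1 ->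
  exists h, [/\ (forall i, 0 < h i), critical h &
    forall h', (forall i, 0 < h' i) -> critical h' -> energy h <= energy h'].
Proof.
move=> h10 ch1.
have [M M1 hM] := close_gaps (energy h1).
have M0 := lt_le_trans ltr01 M1.
pose C := M ^+ N; have C1 : 1 <= C by exact: exprn_ege1.
have C0 := lt_le_trans ltr01 C1.
pose K := [set a : 'rV[R]_N | (forall i, a 0 i \in `[C^-1, 1]) /\
  \sum_i (gam i * a 0 i) *: u i = 0].
have toK h : (forall i, 0 < h i) -> critical h -> gap_sets M h = finset.set0 ->
    exists2 a, K a & energy (fun i => (a 0 i)^-1) = energy h.
  move=> h0 ch G0.
  have [i0 _] := inhabited_index span_pos.
  have [b _ bmin] : exists2 i, i \in [set: 'I_N]%SET & forall j, j \in [set: 'I_N]%SET -> - h j <= - h i.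
    by apply: finset_argmax; apply/set0Pn; exists i0; rewrite inE.
  exists (\row_i (h b / h i)).
    split=> [i|].
      rewrite mxE in_itv /=; apply/andP; split.
        rewrite ler_pdivlMr// mulrC ler_pdivrMr// mulrC.
        exact: no_gap_ratio.
      by rewrite ler_pdivrMr// mul1r -lerN2 bmin// inE.
    under eq_bigr do rewrite mxE mulrCA -scalerA.
    by rewrite -scaler_sumr ch scaler0.
  have b0 : 0 < (h b)^-1 by rewrite invr_gt0.
  rewrite -(energy_scale gam span_pos b0 h0).
  by congr (energy _); apply/funext => i; rewrite mxE invf_div mulrC.
have K_pos a : K a -> forall i, 0 < a 0 i.
  by move=> [aC _] i; have := aC i; rewrite in_itv /= => /andP[/lt_le_trans + _]; apply; rewrite invr_gt0.
have K_crit a : K a -> critical (fun i => (a 0 i)^-1).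
  by move=> [_ E]; rewrite /critical -[RHS]E; apply: eq_bigr => i _; rewrite invrK.
have cK : compact K.
  pose B := [set a : 'rV[R]_N | forall i, a 0 i \in `[C^-1, 1]].
  have cB : compact B.
    apply: (@rV_compact _ _ (fun=> `[C^-1, 1]%classic)).
    by move=> i; exact: segment_compact.
  pose w j : 'rV[R]_N := \row_i (gam i * u i 0 j).
  have -> : K = B `&` \bigcap_(j in [set: 'I_n.+1]) [set a | dotp a (w j) = 0].
    apply/seteqP; split=> a [aB aE]; split=> //.
      move=> j _; have := congr1 (fun x : 'rV_n.+1 => x 0 j) aE.
      rewrite /= summxE mxE dotpE => E; rewrite -[RHS]E; apply: eq_bigr => i _.
      by rewrite !mxE mulrA [a 0 i * _]mulrC.
    apply/rowP => j; have := aE j I; rewrite /= dotpE summxE mxE => E.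
    by rewrite -[RHS]E; apply: eq_bigr => i _; rewrite !mxE mulrA [a 0 i * _]mulrC.
  apply: compact_closedI => //; apply: closed_bigI => j _.
  have /continuous_closedP/(_ [set 0]) := @continuous_dotp R N (w j).
  by apply; exact: closed_eq.
have [h2 [h20 ch2 Ph2 G2]] := hM h1 h10 ch1 (lexx _).
have [a2 Ka2 Pa2] := toK h2 h20 ch2 G2.
have cP : {within K, continuous (fun x : 'rV[R]_N => energy (fun i => (x 0 i)^-1))}.
  apply: continuous_in_subspaceT => a; rewrite inE => Ka.
  by apply: continuous_energy; exact: K_pos.
have [a aK amin] := EVT_min_rV (ex_intro _ a2 Ka2) cK cP.
rewrite inE in aK.
exists (fun i => (a 0 i)^-1); split.
- by move=> i; rewrite invr_gt0 K_pos.
- exact: K_crit.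
move=> h h0 ch; have [hP|hP] := leP (energy h) (energy h1).
  have [h' [h'0 ch' <- G']] := hM h h0 ch hP.
  have [a' Ka' <-] := toK h' h'0 ch' G'.
  by apply: amin; rewrite inE.
rewrite (le_trans _ (ltW hP))// -Ph2 -Pa2; apply: amin; by rewrite inE.
Qed.

End minimiser.

(** * Variation of a minimiser *)

Section variation.
Context {R : realType} {n N : nat}.
Variables (u : 'I_N -> 'rV[R]_n.+1) (gam : 'I_N -> R).
Hypothesis gam0 : forall i, 0 < gam i.
Hypothesis span_pos : forall v, v != 0 -> exists i, dotp (u i) v < 0.
Implicit Types (h : 'I_N -> R).
Local Notation V := (polyhedron_vol u).
Local Notation T := (total_mass gam).
Local Notation critical := (critical u gam).
Local Notation energy := (energy u gam).

Lemma ln_le_sub1 (x : R) : 0 < x -> ln x <= x - 1.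
Proof.
move=> x0; have := @le_ln1Dx R (x - 1); rewrite (_ : 1 + (x - 1) = x); last by ring.
by apply; lra.
Qed.

Lemma ln_ge_1subV (x : R) : 0 < x -> 1 - x^-1 <= ln x.
Proof.
move=> x0; have := @ln_le_sub1 x^-1; rewrite invr_gt0 lnV ?posrE// => /(_ x0).
by lra.
Qed.

Lemma ln_sub_le (x v y : R) : 0 < x -> 0 < v -> 0 <= 1 - y ->
  ln x - ln v <= y -> x * (1 - y) <= v.
Proof.
move=> x0 v0 y1 le; have xE : x <= v * expR y.
  rewrite -ler_ln ?posrE ?mulr_gt0 ?expR_gt0// lnM ?posrE ?expR_gt0// expRK.
  by rewrite -lerBlDl.
apply: (@le_trans _ _ (v * expR y * (1 - y))); first by rewrite ler_wpM2r.
rewrite -mulrA ler_piMr ?(ltW v0)//.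
rewrite (@le_trans _ _ (expR y * expR (- y)))//.
  by rewrite ler_pM2l ?expR_gt0// expR_ge1Dx.
by rewrite -expRD subrr expR0.
Qed.

Definition log_product h (z : 'rV[R]_n.+1) := \sum_i gam i * ln (h i - dotp z (u i)).

(** Where some h_i - z . u_i is less than d, its logarithm is so negative that the
function is below its value at the origin, the others being bounded above.  So
it is enough to maximise over a compact subset of the interior. *)
Lemma log_product_max h : (forall i, 0 < h i) ->
  exists2 z, (forall i, 0 < h i - dotp z (u i)) &
    forall y, (forall i, 0 < h i - dotp y (u i)) -> log_product h y <= log_product h z.
Proof.
move=> h0.
have [c hc] := polyhedron_bounded span_pos h.
pose C := 1 + \sum_i (h i + \sum_j `|c| * `|u i 0 j|).
have sub0 i : 0 <= h i + \sum_j `|c| * `|u i 0 j|.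
  by rewrite addr_ge0 ?(ltW (h0 i))// sumr_ge0// => j _; rewrite mulr_ge0.
have C1 : 1 <= C by rewrite lerDl sumr_ge0.
have C0 := lt_le_trans ltr01 C1.
have Cle y i : (forall i, 0 < h i - dotp y (u i)) -> h i - dotp y (u i) <= C.
  move=> y0; have yP : polyhedron u h y by move=> j; rewrite ltW// -subr_gt0.
  rewrite /C (bigD1 i)//= [1 + _]addrC -addrA ler_wpDr ?addr_ge0 ?sumr_ge0//.
  rewrite lerD2l dotpE -sumrN; apply: ler_sum => j _.
  rewrite (le_trans (ler_norm _))// normrN normrM ler_wpM2r//.
  by rewrite (le_trans (hc y yP j))// ler_norm.
pose K := `|log_product h 0| + T * ln C + 1.
pose d := \big[Num.min/1]_i (Num.min (h i) (expR (- K / gam i))).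
have d0 : 0 < d by apply: lt_bigmin => // i _; rewrite lt_min h0 expR_gt0.
have dle i : d <= Num.min (h i) (expR (- K / gam i)) by rewrite /d; exact: bigmin_le_cond.
have dh i : d <= h i by rewrite (le_trans (dle i))// ge_min lexx.
have dK i : gam i * ln d <= - K.
  rewrite mulrC -ler_pdivlMr// -[leRHS]expRK ler_ln ?posrE ?expR_gt0//.
  by rewrite (le_trans (dle i))// ge_min lexx orbT.
pose A := [set z : 'rV[R]_n.+1 | forall i, d <= h i - dotp z (u i)].
have A0 : A 0 by move=> i; rewrite dotp0l subr0.
have AE : A = polyhedron u (fun i => h i - d).
  by apply/seteqP; split => z hz i; have := hz i; lra.
have cA : compact A.
  apply: bounded_closed_compact.
    have [b hb] := polyhedron_bounded span_pos (fun i => h i - d).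
    exists b; split=> [|M bM z]; [exact: num_real|rewrite /= AE => zA].
    have b0 : 0 <= b := le_trans (normr_ge0 _) (hb z zA 0).
    rewrite /Num.norm /= mx_normrE; apply/bigmax_leP; split.
      exact: le_trans b0 (ltW bM).
    by move=> [i j] _ /=; rewrite (ord1 i) (le_trans (hb z zA j))// ltW.
  rewrite AE (_ : polyhedron u _ = \bigcap_(i in setT) [set x | dotp x (u i) <= h i - d]).
    apply: closed_bigI => i _.
    have /continuous_closedP/(_ [set x | x <= h i - d]) := @continuous_dotp R _ (u i).
    by apply; exact: closed_le.
  by apply/seteqP; split=> [x hx i _|x hx i]; [exact: hx|exact: (hx i)].
have cf : {within A, continuous (log_product h)}.
  apply: continuous_in_subspaceT => z; rewrite inE => Az.
  apply: continuous_sum => i; apply: continuousM; first exact: cst_continuous.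
  apply: (@continuous_comp _ _ _ (fun z => h i - dotp z (u i)) (@ln R)).
    apply: continuousB; first exact: cst_continuous.
    exact: continuous_dotp.
  by apply: continuous_ln; exact: lt_le_trans d0 (Az i).
have [z zA zmax] := EVT_max_rV (ex_intro _ 0 A0) cA cf.
rewrite inE in zA.
exists z => [i|y y0]; first exact: lt_le_trans d0 (zA i).
have [yA|] := pselect (A y); first by apply: zmax; rewrite inE.
move=> /existsNP[i /negP]; rewrite -ltNge => yi.
apply: (@le_trans _ _ (log_product h 0)); last by apply: zmax; rewrite inE.
rewrite /log_product (bigD1 i)//=.
have le1 : gam i * ln (h i - dotp y (u i)) <= - K.
  by apply: le_trans (dK i); rewrite ler_pM2l// ler_ln ?posrE// ltW.
have le2 : \sum_(j | j != i) gam j * ln (h j - dotp y (u j)) <= T * ln C.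
  apply: (@le_trans _ _ (\sum_(j | j != i) gam j * ln C)).
    apply: ler_sum => j _; rewrite ler_pM2l// ler_ln ?posrE//; exact: Cle.
  rewrite -mulr_suml ler_wpM2r ?ln_ge0//.
  by rewrite /total_mass [leRHS](bigD1 i)//= lerDr ltW.
rewrite (le_trans (lerD le1 le2))// /K.
rewrite -[\sum_(_ < _) _]/(log_product h 0).
have := ler_norm (- log_product h 0); rewrite normrN; move: (T * _) => x.
by lra.
Qed.

(** At the maximum z of [log_product] the gradient is - w, where w is the sum in the
critical relation for the translate by z.  If w were not 0 then moving z by
- t w for a small t > 0 would increase the function. *)
Lemma centering h : (forall i, 0 < h i) ->
  exists2 z, (forall i, 0 < h i - dotp z (u i)) &
    critical (fun i => h i - dotp z (u i)).
Proof.
move=> h0; have [z z0 zmax] := log_product_max h0; exists z => //.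
rewrite /critical; set w := \sum_i _; apply/eqP; apply: contraT => w0.
have ww := dotp_gt0 w0.
pose g i := h i - dotp z (u i).
pose a i := - dotp w (u i) / g i.
have sa : \sum_i gam i * a i = - dotp w w.
  rewrite {2}/w dotp_sumr -sumrN; apply: eq_bigr => i _.
  by rewrite dotpZr /a -/(g i); ring.
pose A := \sum_i `|a i|.
have aA i : `|a i| <= A by rewrite /A (bigD1 i)//= lerDl sumr_ge0.
have A0 : 0 <= A by exact: sumr_ge0.
pose Q := \sum_i gam i * (2 * a i ^+ 2).
have Q0 : 0 <= Q.
  by apply: sumr_ge0 => i _; rewrite (mulr_ge0 (ltW (gam0 i)))// mulr_ge0 ?sqr_ge0.
(* The first bound keeps all factors 1 - t a_i at least 1/2, the second makes the
   quadratic error t Q smaller than the linear gain w . w. *)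
pose t := Num.min (1 / (2 * (1 + A))) (dotp w w / (2 * (1 + Q))).
have t0 : 0 < t by rewrite lt_min !divr_gt0 ?mulr_gt0// ltr_pwDl.
have A1 : 1 + A != 0 by rewrite gt_eqF// ltr_pwDl.
have Q1 : 1 + Q != 0 by rewrite gt_eqF// ltr_pwDl.
have tA i : t * a i <= 1 / 2.
  apply: (@le_trans _ _ (1 / (2 * (1 + A)) * (1 + A))).
    apply: (@le_trans _ _ (t * (1 + A))).
      by rewrite ler_pM2l// (le_trans (ler_norm _))// (le_trans (aA i))// lerDr.
    by rewrite ler_pM2r ?ltr_pwDl// ge_min lexx.
  by rewrite le_eqVlt; apply/orP; left; apply/eqP; field.
have tQ : t * Q <= dotp w w / 2.
  apply: (@le_trans _ _ (dotp w w / (2 * (1 + Q)) * (1 + Q))).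
    rewrite ler_pM ?(ltW t0)//; first by rewrite ge_min lexx orbT.
    by rewrite lerDr.
  by rewrite le_eqVlt; apply/orP; left; apply/eqP; field.
have pos i : 0 < 1 - t * a i by have := tA i; lra.
have shift i : h i - dotp (z - t *: w) (u i) = g i * (1 - t * a i).
  rewrite dotpDl dotpNl dotpZl /a; have := z0 i; rewrite -/(g i) => gi.
  have -> : h i = g i + dotp z (u i) by rewrite /g subrK.
  by field; rewrite gt_eqF.
have := zmax (z - t *: w); rewrite /log_product => le.
have {}le : \sum_i gam i * ln (1 - t * a i) <= 0.
  rewrite -(lerD2l (\sum_i gam i * ln (g i))) addr0 -big_split /=.
  rewrite (eq_bigr (fun i => gam i * ln (h i - dotp (z - t *: w) (u i)))).
    by apply: le => i; rewrite shift mulr_gt0// z0.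
  by move=> i _; rewrite shift lnM ?posrE ?mulrDr// z0.
have le2 : 0 <= \sum_i gam i * (a i + 2 * t * a i ^+ 2).
  rewrite -(pmulr_rge0 _ t0) -oppr_le0 (le_trans _ le)// mulr_sumr -sumrN.
  apply: ler_sum => i _; rewrite mulrCA -mulrN ler_pM2l//.
  apply: le_trans (ln_ge_1subV (pos i)).
  have -> : 1 - (1 - t * a i)^-1 = - (t * (a i / (1 - t * a i))).
    by field; rewrite gt_eqF.
  rewrite lerN2 ler_pM2l// ler_pdivrMr// -subr_ge0.
  have -> : (a i + 2 * t * a i ^+ 2) * (1 - t * a i) - a i =
    t * a i ^+ 2 * (2 * (1 / 2 - t * a i)) by field.
  by rewrite mulr_ge0 //; [rewrite mulr_ge0 ?(ltW t0) ?sqr_ge0|rewrite mulr_ge0// subr_ge0].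
have : \sum_i gam i * (a i + 2 * t * a i ^+ 2) = - dotp w w + t * Q.
  rewrite -sa /Q mulr_sumr -big_split /=; apply: eq_bigr => i _; ring.
by move=> E; move: le2; rewrite E; lra.
Qed.

(** Compare the energy of h with that of a critical translate of the displaced
vector.  The bound ln x <= x - 1 makes the translation contribute the pairing of
z with the critical relation for h, which is 0. *)
Lemma minimiser_variation h i0 t :
  (forall i, 0 < h i) -> critical h ->
  (forall h', (forall i, 0 < h' i) -> critical h' -> energy h <= energy h') ->
  (forall i, 0 < shift_facet h i0 t i) ->
  ln (V (shift_facet h i0 t)) - ln (V h) <=
  n.+1%:R * gam i0 / (T * h i0) * t.
Proof.
move=> h0 ch hmin ht0; set ht := shift_facet h i0 t in ht0 *.
have [z z0 cz] := centering ht0.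
have := hmin _ z0 cz; rewrite /energy polyhedron_vol_translate.
have T0 := total_mass_gt0 gam0 span_pos.
have le1 : \sum_i gam i * ln (ht i - dotp z (u i)) <=
    \sum_i gam i * ln (h i) + gam i0 * (t / h i0).
  have -> : gam i0 * (t / h i0) = \sum_i gam i * ((ht i - dotp z (u i)) / h i - 1).
    rewrite (eq_bigr (fun i => gam i * ((ht i - h i) / h i) -
        gam i / h i * dotp z (u i))) => [|i _]; last by field; rewrite gt_eqF.
    rewrite sumrB critical_dotp// subr0 (bigD1 i0)//= big1 => [|i ii0].
      by rewrite addr0 /ht /shift_facet eqxx mulr1n [h i0 + t]addrC addrK.
    by rewrite /ht /shift_facet (negPf ii0) addr0 subrr mul0r mulr0.
  rewrite -big_split /=; apply: ler_sum => i _; rewrite -mulrDr ler_pM2l//.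
  rewrite -lerBlDl -ln_div ?posrE//; apply: ln_le_sub1.
  by rewrite divr_gt0.
move=> le2.
have le3 : T / n.+1%:R * (ln (V ht) - ln (V h)) <= gam i0 * (t / h i0).
  rewrite mulrBr; move: le1 le2; move: (T / _ * _) (T / _ * _) => x y.
  by move: (\sum_i _) (\sum_i _) => p q; lra.
have Td : 0 < T / n.+1%:R by rewrite divr_gt0.
rewrite -(ler_pM2l Td) (le_trans le3)// le_eqVlt; apply/orP; left; apply/eqP.
have : (n.+1%:R : R) != 0 by rewrite pnatr_eq0.
by move: (n.+1%:R : R) => d dn0; field; rewrite dn0 !gt_eqF.
Qed.

Hypothesis u1 : forall i, dotp (u i) (u i) = 1.
Hypothesis u_inj : injective u.

(** Displace the facet by t > 0 in [slab_lower] and by - t in [slab_upper].  Dividing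
the resulting inequalities by t and letting t tend to 0, the area of the
strengthened facet is at most, and that of the relaxed facet at least, the given
value.  The limit is taken by contradiction, with an explicit t. *)
Lemma minimiser_facet_area h i0 B :
  (forall i, 0 < h i) -> critical h ->
  (forall h', (forall i, 0 < h' i) -> critical h' -> energy h <= energy h') ->
  orthonormal_basis_perp (u i0) B ->
  vol n (facet_slice u h i0 B 0) = (V h * (n.+1%:R * gam i0 / (T * h i0)))%:E.
Proof.
move=> h0 ch hmin hB; set k := n.+1%:R * gam i0 / (T * h i0).
have T0 := total_mass_gt0 gam0 span_pos.
have V0 := polyhedron_vol_gt0 span_pos h0.
have k0 : 0 < k by rewrite divr_gt0 ?mulr_gt0.
have hvar t : (forall i, 0 < shift_facet h i0 t i) ->
    ln (V (shift_facet h i0 t)) - ln (V h) <= k * t.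
  exact: minimiser_variation.
move: k k0 hvar => k k0 hvar.
have uneq j : j != i0 -> u j != u i0 by apply: contra => /eqP/u_inj ->.
have fin d : vol n (facet_slice u h i0 B d) = (fine (vol n (facet_slice u h i0 B d)))%:E.
  rewrite fineK// ge0_fin_numE ?measure_ge0//.
  apply: facet_slice_finite => //; exact: polyhedron_bounded.
apply/eqP; rewrite eq_le; apply/andP; split.
  apply: (facet_slice_le u1 h0 uneq hB) => d d0; rewrite fin.
  set s := fine _; rewrite lee_fin leNgt; apply/negP => Vs.
  have s0 : 0 < s by rewrite (lt_trans _ Vs)// mulr_gt0.
  pose t := Num.min d ((s - V h * k) / (2 * s * k)).
  have t0 : 0 < t.
    rewrite lt_min d0 /=; apply: divr_gt0; first by rewrite subr_gt0.
    by rewrite mulr_gt0// mulr_gt0.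
  have td : 0 <= t <= d by rewrite ltW//= ge_min lexx.
  have ht0 i : 0 < shift_facet h i0 t i.
    by rewrite /shift_facet ltr_wpDr// mulrn_wge0// ltW.
  have tk : s * k * t <= (s - V h * k) / 2.
    rewrite (@le_trans _ _ (s * k * ((s - V h * k) / (2 * s * k))))//.
      by rewrite ler_pM2l ?mulr_gt0// ge_min lexx orbT.
    by rewrite le_eqVlt; apply/orP; left; apply/eqP; field; rewrite !gt_eqF.
  have kt1 : 0 <= 1 - k * t.
    rewrite -(pmulr_rge0 _ s0) mulrBr mulrA subr_ge0 mulr1 (le_trans tk)//.
    by have := mulr_gt0 V0 k0; lra.
  have := slab_lower h u1 hB td; rewrite fin !(polyhedron_volE span_pos).
  rewrite -/s -EFinM -EFinD lee_fin => le1.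
  have le2 := hvar _ ht0.
  have := ln_sub_le (polyhedron_vol_gt0 span_pos ht0) V0 kt1 le2.
  move=> /(le_trans (ler_wpM2r kt1 le1)) le3.
  have : 0 < t * ((s - V h * k) - s * k * t).
    by rewrite mulr_gt0//; lra.
  by lra.
apply: (facet_slice_ge u1 hB (polyhedron_bounded span_pos)) => d d0; rewrite fin.
set s := fine _; rewrite lee_fin leNgt; apply/negP => Vs.
have s0 : 0 <= s by rewrite fine_ge0 ?measure_ge0.
have sk0 : 0 < s * k + 1 by rewrite ltr_wpDl// mulr_ge0// ltW.
pose t := Num.min (Num.min d (h i0 / 2)) ((V h * k - s) / (2 * (s * k + 1))).
have t0 : 0 < t.
  rewrite !lt_min d0 /= divr_gt0//=; apply: divr_gt0; first by rewrite subr_gt0.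
  by rewrite mulr_gt0.
have td : 0 <= t <= d by rewrite ltW//= !ge_min lexx.
have th : t <= h i0 / 2 by rewrite !ge_min lexx orbT.
have ht0 i : 0 < shift_facet h i0 (- t) i.
  rewrite /shift_facet; have [->|_] := eqVneq i i0; last by rewrite mulr0n addr0.
  by rewrite mulr1n; have := h0 i0; lra.
have tk : (s * k + 1) * t <= (V h * k - s) / 2.
  rewrite (@le_trans _ _ ((s * k + 1) * ((V h * k - s) / (2 * (s * k + 1)))))//.
    by rewrite ler_pM2l// !ge_min lexx !orbT.
  by rewrite le_eqVlt; apply/orP; left; apply/eqP; field; rewrite !gt_eqF.
have kt1 : 0 <= 1 - k * - t by rewrite mulrN opprK addr_ge0// mulr_ge0// ltW.
have := slab_upper h u1 hB td; rewrite fin !(polyhedron_volE span_pos).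
rewrite -/s -EFinM -EFinD lee_fin => le1.
have le2 := hvar _ ht0.
have := ln_sub_le (polyhedron_vol_gt0 span_pos ht0) V0 kt1 le2.
move: le1; rewrite -lerBlDr => le1 /(le_trans (ler_wpM2r kt1 le1)) le3.
have : 0 < t * ((V h * k - s) - s * k * t).
  by rewrite mulr_gt0//; lra.
by lra.
Qed.

End variation.

(** * Bounded polyhedra as polytopes and their facets *)

Lemma sup_max (R : realType) (A : set R) (a : R) : A a -> ubound A a -> sup A = a.
Proof.
move=> Aa ua; apply/eqP; rewrite eq_le; apply/andP; split.
  by apply: ge_sup => //; exists a.
by apply: ub_le_sup => //; exists a.
Qed.

Lemma inf_min (R : realType) (A : set R) (a : R) : A a -> lbound A a -> inf A = a.
Proof.
move=> Aa la; apply/eqP; rewrite eq_le; apply/andP; split.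
  by apply: ge_inf => //; exists a.
by apply: lb_le_inf => //; exists a.
Qed.

Section polytope.
Context {R : realType} {n N : nat}.
Variables (u : 'I_N -> 'rV[R]_n.+1) (h : 'I_N -> R).
Hypothesis span_pos : forall v, v != 0 -> exists i, dotp (u i) v < 0.
Hypothesis h0 : forall i, 0 < h i.
Local Notation P := (polyhedron u h).

Definition active (x : 'rV[R]_n.+1) : {set 'I_N} := [set i | dotp x (u i) == h i]%SET.

Definition vertex (x : 'rV[R]_n.+1) :=
  P x /\ forall w, (forall i, i \in active x -> dotp w (u i) = 0) -> w = 0.

(** A vertex is determined by its set of active constraints. *)
Lemma finite_vertices : finite_set vertex.
Proof.
pose g I := xget 0 [set x | vertex x /\ active x = I].
apply: (@sub_finite_set _ _ (range g)); last exact/finite_image/finite_finset.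
move=> x vx; exists (active x) => //; rewrite /g.
have [[Pz vz] zE] : vertex (g (active x)) /\ active (g (active x)) = active x.
  by apply: (@xgetPex _ 0 [set z | vertex z /\ active z = active x]); exists x.
rewrite -/(g _) in Pz vz zE *; apply/eqP; rewrite -subr_eq0; apply/eqP.
apply: vz => i; rewrite dotpDl dotpNl => iz.
have := iz; rewrite inE => /eqP ->.
by move: iz; rewrite zE inE => /eqP ->; rewrite subrr.
Qed.

(** Walk from x in the direction w, along which the active constraints stay active,
until another constraint stops the walk. *)
Lemma boundary_walk x w : P x -> w != 0 -> (forall i, i \in active x -> dotp w (u i) = 0) ->
  exists2 t, 0 < t & P (x + t *: w) /\ active x \proper active (x + t *: w).
Proof.
move=> Px w0 hw.
have [i0 wi0] : exists i, 0 < dotp w (u i).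
  have : - w != 0 by rewrite oppr_eq0.
  by move=> /span_pos[i]; rewrite dotpNr oppr_lt0 dotpC; exists i.
pose r i := (h i - dotp x (u i)) / dotp w (u i).
have [k wk rmin] := @arg_minP _ _ _ i0 (fun i => 0 < dotp w (u i)) r wi0.
have nact i : 0 < dotp w (u i) -> 0 < r i.
  move=> wi; rewrite divr_gt0// subr_gt0 lt_neqAle Px andbT.
  by apply/negP => ia; move: wi; rewrite hw ?ltxx// inE.
exists (r k); first exact: nact.
split.
  move=> i; rewrite dotpDl dotpZl -lerBrDl.
  have [wi|wi] := ltP 0 (dotp w (u i)).
    by rewrite -ler_pdivlMr// rmin.
  by rewrite (@le_trans _ _ 0)// ?subr_ge0 ?Px// mulr_ge0_le0// ltW// nact.
apply/properP; split.
  apply/fintype.subsetP => i ia; rewrite inE dotpDl dotpZl hw// mulr0 addr0.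
  by rewrite inE in ia.
have wk0 : dotp w (u k) != 0 by rewrite gt_eqF.
exists k; first by rewrite inE dotpDl dotpZl /r divfK// addrC subrK.
by apply/negP => /hw E; rewrite E eqxx in wk0.
Qed.

(** A point that is not a vertex lies between the ends of the walks in two opposite
directions, both of which have more active constraints. *)
Lemma polyhedron_convex_hull : P = convex_hull vertex.
Proof.
apply/seteqP; split => [x Px A [cA sA]|].
  have [k] := ubnP (N - #|active x|)%N; elim: k x Px => // k IH x Px kN.
  have [[w [w0 hw]]|nw] := pselect (exists w, w != 0 /\ forall i, i \in active x -> dotp w (u i) = 0);
    last first.
    apply: sA; split=> // w hw; apply/eqP/negPn/negP => w0; apply: nw; by exists w.
  have lt_card y : active x \proper active y -> (N - #|active y| < k)%N.
    move=> /proper_card lt; rewrite -ltnS; apply: leq_trans kN; rewrite ltnS.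
    apply: ltn_sub2l => //; apply: (leq_trans lt).
    by rewrite -[leqRHS](card_ord N) max_card.
  have [t t0 [Pt /lt_card/(IH _ Pt) At]] := boundary_walk Px w0 hw.
  have w0' : - w != 0 by rewrite oppr_eq0.
  have hw' i : i \in active x -> dotp (- w) (u i) = 0 by move=> /hw; rewrite dotpNl => ->; rewrite oppr0.
  have [s s0 [Ps /lt_card/(IH _ Ps) As]] := boundary_walk Px w0' hw'.
  have st0 : 0 < s + t by rewrite addr_gt0.
  have l0 : 0 <= s / (s + t) by rewrite divr_ge0 ?ltW.
  have l1 : s / (s + t) <= 1 by rewrite ler_pdivrMr// mul1r lerDl ltW.
  have := cA _ _ (Itv01 l0 l1) (mem_set At) (mem_set As).
  rewrite inE; congr A; rewrite /conv /=.
  rewrite scalerN !scalerDr scalerN addrACA -scalerDl !scalerA -scalerBl.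
  have -> : s / (s + t) * t - unstable.onem (s / (s + t)) * s = 0.
    by rewrite /unstable.onem; field; rewrite gt_eqF.
  have -> : s / (s + t) + unstable.onem (s / (s + t)) = 1.
    by rewrite /unstable.onem addrC subrK.
  by rewrite scale1r scale0r addr0.
apply: smallest_sub; last by move=> x [].
move=> x y l; rewrite !inE => xP yP i.
rewrite /conv /= dotpDl !dotpZl /unstable.onem.
have l0 : 0 <= l%:num by [].
have l1 : l%:num <= 1 by [].
move: l%:num l0 l1 => c c0 c1.
have le1 := ler_wpM2l c0 (xP i).
have le2 : (1 - c) * dotp y (u i) <= (1 - c) * h i by rewrite ler_wpM2l ?subr_ge0.
by rewrite (le_trans (lerD le1 le2))// -mulrDl addrC subrK mul1r.
Qed.

Lemma polyhedron_is_polytope : is_polytope P.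
Proof.
split; last exact: (vol_polyhedron_gt0 u h0).
by exists vertex; [exact: finite_vertices|exact: polyhedron_convex_hull].
Qed.

Lemma polyhedron_interior0 : interior P 0.
Proof.
rewrite -[interior P 0]/(nbhs (0 : 'rV[R]_n.+1) [set x | forall i, dotp x (u i) <= h i]).
apply: (@filter_forall _ _ (fun i => [set x | dotp x (u i) <= h i]) _
  (nbhs_filter (0 : 'rV[R]_n.+1))) => i.
have /continuousP/(_ [set y | y < h i] (@open_lt R (h i))) op := @continuous_dotp R _ (u i).
have o : open_nbhs (0 : 'rV[R]_n.+1) ((fun x => dotp x (u i)) @^-1` [set y | y < h i]).
  by split=> //=; rewrite dotp0l.
apply: (@filterS _ _ (nbhs_filter (0 : 'rV[R]_n.+1)) _ _ _ (open_nbhs_nbhs o)).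
by move=> x; exact: ltW.
Qed.

Lemma ubound_dotp v : has_ubound [set dotp x v | x in P].
Proof.
have [c hc] := polyhedron_bounded span_pos h.
exists (\sum_j `|c| * `|v 0 j|) => _ [x xP <-]; rewrite dotpE; apply: ler_sum => j _.
rewrite (le_trans (ler_norm _))// normrM ler_wpM2r// (le_trans (hc x xP j))//.
exact: ler_norm.
Qed.

Lemma dotp_le_support v x : P x -> dotp x v <= support_function P v.
Proof. by move=> Px; apply: ub_le_sup; [exact: ubound_dotp|exists x]. Qed.

Lemma support_touching i x : P x -> dotp x (u i) = h i -> support_function P (u i) = h i.
Proof. by move=> Px E; apply: sup_max; [exists x|move=> _ [y Py <-]; exact: Py]. Qed.

Hypothesis u1 : forall i, dotp (u i) (u i) = 1.

Lemma facet_distanceE i x : P x -> dotp x (u i) = h i -> facet_distance P (u i) = h i.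
Proof.
move=> Px E; rewrite /facet_distance (support_touching Px E); apply: inf_min.
  exists (h i *: u i); first by rewrite /= dotpZl u1 mulr1.
  by rewrite dotpZl dotpZr u1 mulr1 -expr2 sqrtr_sqr gtr0_norm.
move=> _ [y /= yE <-]; rewrite -[leLHS]gtr0_norm// -sqrtr_sqr ler_sqrt ?dotp_ge0//.
by have := dotp_CauchySchwarz y (u i); rewrite u1 mulr1 yE.
Qed.

Lemma polyhedron0 : P 0.
Proof. by move=> i; rewrite dotp0l ltW. Qed.

(** The vectors v and the rows of M form a basis, and w - (w . v) v is orthogonal to
all of them. *)
Lemma orthogonal_hyperplane (M : 'M[R]_(n, n.+1)) v w : row_free M ->
  dotp v v = 1 -> (forall k, dotp (row k M) v = 0) ->
  (forall k, dotp (row k M) w = 0) -> w = dotp w v *: v.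
Proof.
move=> fM v1 Mv Mw.
pose Q : 'M[R]_(1 + n, n.+1) := col_mx v M.
have combo (y : 'rV[R]_(1 + n)) z : (forall k, dotp (row k M) z = 0) ->
    dotp (y *m Q) z = lsubmx y 0 0 * dotp v z.
  move=> Mz; rewrite -[y]hsubmxK /Q mul_row_col dotpDl row_mxKl.
  rewrite [lsubmx y]mx11_scalar mul_scalar_mx dotpZl mulmx_sum_row dotp_suml.
  by rewrite big1 ?addr0 ?mxE ?eqxx ?mulr1n// => k _; rewrite dotpZl Mz mulr0.
have uQ : (Q : 'M[R]_n.+1) \in unitmx.
  rewrite -row_free_unit; apply: inj_row_free => y yQ.
  have y0 : lsubmx (y : 'rV_(1 + n)) = 0.
    have := combo y v Mv; rewrite yQ dotp0l v1 mulr1 => /esym E.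
    by apply/rowP => k; rewrite (ord1 k) E mxE.
  move: yQ; rewrite -[y](@hsubmxK _ 1 1 n) /Q (@mul_row_col _ 1 1 n) y0 mul0mx add0r => yM.
  have -> : rsubmx (y : 'rV_(1 + n)) = 0 by apply/eqP; rewrite -(mulmx_free_eq0 _ fM) yM.
  rewrite ?y0; exact: (@row_mx0 _ 1 1 n).
apply/eqP; rewrite -subr_eq0 -dotp_eq0; apply/eqP.
set d := w - _.
have dv : dotp v d = 0 by rewrite /d dotpC dotpDl dotpNl dotpZl v1 mulr1 subrr.
have Md k : dotp (row k M) d = 0 by rewrite /d dotpDr dotpNr dotpZr Mv Mw mulr0 subrr.
rewrite -{1}[d](mulmxKV uQ).
by rewrite combo// dv mulr0.
Qed.

(** Let y be the barycentre of n affinely independent points of the face.  If y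
satisfies all constraints strictly then v is not maximal at y.  If y is on the
j-th hyperplane, so are all these points, and u_j = v or u_j = - v; the latter is
excluded since the origin is strictly inside. *)
Lemma facet_normal_is_constraint (v : 'rV[R]_n.+1) x (M : 'M[R]_(n, n.+1)) :
  dotp v v = 1 -> row_free M -> face P v x -> (forall k, face P v (x + row k M)) ->
  exists i, v = u i.
Proof.
move=> v1 fM [Px xE] hM.
pose y := x + (n.+1%:R^-1 : R) *: \sum_k row k M.
have c0 : 0 < (n.+1%:R^-1 : R) by rewrite invr_gt0.
have yE z : dotp y z = n.+1%:R^-1 * (dotp x z + \sum_k dotp (x + row k M) z).
  rewrite /y dotpDl dotpZl dotp_suml.
  under [in RHS]eq_bigr do rewrite dotpDl.
  rewrite big_split /= sumr_const card_ord -[dotp x z *+ n]mulr_natl.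
  have : (n.+1%:R : R) != 0 by rewrite pnatr_eq0.
  rewrite -natr1; move: (\sum_k _) => S nn.
  by field.
have sumh (a : R) : n.+1%:R^-1 * (a + \sum_(k < n) a) = a.
  have n0 : (n.+1%:R : R) != 0 by rewrite pnatr_eq0.
  by rewrite sumr_const card_ord -mulrS -[a *+ _]mulr_natl mulKf.
have Py : P y.
  move=> i; rewrite yE -[leRHS]sumh ler_pM2l// lerD ?Px// ler_sum// => k _.
  by have [] := hM k.
have ys : dotp y v = support_function P v.
  rewrite yE xE -[RHS]sumh; congr (_ * (_ + _)); apply: eq_bigr => k _.
  by have [] := hM k.
have [[j yj]|nj] := pselect (exists j, dotp y (u j) = h j).
  have slack : (h j - dotp x (u j)) + \sum_k (h j - dotp (x + row k M) (u j)) = 0.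
    have := yE (u j); rewrite yj -{1}[h j]sumh => /(mulfI (lt0r_neq0 c0)) E.
    by rewrite sumrB; lra.
  have s1 : 0 <= h j - dotp x (u j) by rewrite subr_ge0 Px.
  have s2 k : 0 <= h j - dotp (x + row k M) (u j) by rewrite subr_ge0; have [] := hM k.
  move/eqP: slack; rewrite paddr_eq0 ?sumr_ge0// => /andP[/eqP x0].
  rewrite psumr_eq0// => /allP M0.
  have Mu k : dotp (row k M) (u j) = 0.
    have /eqP := M0 k (mem_index_enum k); rewrite dotpDl; lra.
  have Mv k : dotp (row k M) v = 0 by have [_] := hM k; rewrite dotpDl xE; lra.
  have := orthogonal_hyperplane fM v1 Mv Mu; set c := dotp (u j) v => uE.
  have := u1 j; rewrite uE dotpZl dotpZr v1 mulr1 -expr2 => /eqP.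
  rewrite sqrf_eq1 => /orP[] /eqP c1; first by exists j; rewrite uE c1 scale1r.
  have := h0 j; rewrite -yj uE c1 scaleN1r dotpNr ys oppr_gt0 ltNge.
  by have := dotp_le_support v polyhedron0; rewrite dotp0l => ->.
pose e := \big[Num.min/1]_j (h j - dotp y (u j)).
have e0 : 0 < e.
  apply: lt_bigmin => // j _; rewrite subr_gt0 lt_neqAle Py andbT.
  by apply/eqP => E; apply: nj; exists j.
have : P (y + e *: v).
  move=> j; rewrite dotpDl dotpZl -lerBrDl.
  apply: (@le_trans _ _ (e * 1)).
    rewrite ler_pM2l// (le_trans (ler_norm _))//; exact: dotp_unit_le1.
  by rewrite mulr1 /e; exact: bigmin_le_cond.
move=> /(dotp_le_support v); rewrite dotpDl dotpZl v1 mulr1 ys.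
by rewrite gerDl leNgt e0.
Qed.

Hypothesis u_inj : injective u.

(** Since the facet has positive area, it contains a point at which all other
constraints hold with some margin d > 0; moving by d in the directions of an
orthonormal basis of the hyperplane stays in the polyhedron. *)
Lemma constraint_is_facet_normal i B : orthonormal_basis_perp (u i) B ->
  (0 < vol n (facet_slice u h i B 0))%E ->
  exists x (M : 'M[R]_(n, n.+1)), [/\ P x, dotp x (u i) = h i, row_free M,
     face P (u i) x & forall k, face P (u i) (x + row k M)].
Proof.
move=> hB area.
have uneq j : j != i -> u j != u i by apply: contra => /eqP/u_inj ->.
have [d [d0 [y hy]]] : exists d, 0 < d /\ exists y, facet_slice u h i B (- d) y.
  apply: contrapT => nex; move: area; rewrite ltNge => /negP; apply.
  apply: (facet_slice_le u1 h0 uneq hB) => d d0.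
  rewrite (_ : facet_slice _ _ _ _ _ = set0) ?measure0// -subset0 => y hy.
  by apply: nex; exists d; split=> //; exists y.
pose x := h i *: u i + y *m B.
have xi : dotp x (u i) = h i by rewrite frame_coord.
have xj j : j != i -> dotp x (u j) <= h j - d by exact: hy.
have Px : P x.
  move=> j; have [->|ji] := eqVneq j i; first by rewrite xi.
  by rewrite (le_trans (xj j ji))// gerBl ltW.
have [BB _] := hB.
have rowi k : dotp (row k B) (u i) = 0 by rewrite rowE (perp_dotp hB).
have rowj k j : dotp (row k B) (u j) <= 1.
  rewrite (le_trans (ler_norm _))//; apply: dotp_unit_le1 => //.
  have E : (B *m B^T) k k = 1 by rewrite BB mxE eqxx.
  by rewrite -[RHS]E dotpE mxE; apply: eq_bigr => l _; rewrite !mxE.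
have Pk k : P (x + row k (d *: B)).
  move=> j; rewrite dotpDl linearZ /= dotpZl.
  have [->|ji] := eqVneq j i; first by rewrite rowi mulr0 addr0 xi.
  rewrite (@le_trans _ _ (h j - d + d * 1))//; last by rewrite mulr1 subrK.
  by rewrite lerD ?xj// ler_pM2l.
exists x, (d *: B); split=> //.
- apply/row_freeP; exists (d^-1 *: B^T).
  by rewrite -scalemxAl -scalemxAr scalerA divff ?gt_eqF// scale1r.
- by split=> //; rewrite (support_touching Px xi).
- move=> k; split; first exact: Pk.
  by rewrite (support_touching Px xi) dotpDl linearZ /= dotpZl rowi mulr0 addr0.
Qed.

Lemma hyperplane_measure_face i : support_function P (u i) = h i ->
  hyperplane_measure (u i) (face P (u i)) =
  vol n (facet_slice u h i (xget 0 (orthonormal_basis_perp (u i))) 0).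
Proof.
move=> sE; rewrite /hyperplane_measure; set B := xget _ _.
have hB : orthonormal_basis_perp (u i) B.
  exact: xgetPex (orthonormal_basis_perp_ex (u1 i)).
congr (vol n _); apply/seteqP; split.
  move=> _ [x [Px xE] <-] j ji; rewrite addr0 -[X in dotp X _](_ : x = _) ?Px//.
  by rewrite [LHS](frame_decomp (u1 i) hB) xE sE.
move=> y hy; exists (h i *: u i + y *m B); last by rewrite (frame_proj hB).
split; last by rewrite sE (frame_coord (u1 i) hB).
move=> j; have [->|ji] := eqVneq j i; first by rewrite (frame_coord (u1 i) hB).
by have := hy j ji; rewrite addr0.
Qed.

End polytope.

(** * Discrete measures on the sphere *)

Section sphere_sets.
Context {R : realType} {n : nat}.
Local Notation V := 'rV[R]_n.+1.

Lemma open_sphere_preimage (A : set V) : open A ->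
  open [set x : sphere R n | A (\val x)].
Proof.
move=> oA; have /continuousP := @initial_continuous _ _ (@set_val V (@unit_sphere R n)).
exact.
Qed.

Lemma measurable_sphere_open (A : set V) : open A ->
  measurable ([set x : sphere R n | A (\val x)] : set (borel_sphere R n)).
Proof. by move=> oA; apply: sub_sigma_algebra; exact: open_sphere_preimage. Qed.

Lemma measurable_sphere_closed (A : set V) : closed A ->
  measurable ([set x : sphere R n | A (\val x)] : set (borel_sphere R n)).
Proof.
move=> cA; rewrite -[X in measurable X]setCK; apply: measurableC.
exact: (@measurable_sphere_open (~` A) (closed_openC cA)).
Qed.

(** The subspace is the set of solutions of the linear equations given by the
cokernel of a matrix whose row space it is. *)
Lemma closed_vspace (X : {vspace V}) : closed [set x : V | x \in X].
Proof.
pose W : 'M[R]_(\dim X, n.+1) := \matrix_i (vbasis X)`_i.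
have memE x : (x \in X) = (x *m cokermx W == 0).
  rewrite -submxE; apply/idP/idP => [xX|/submxP[D ->]].
    apply/submxP; exists (\row_i coord (vbasis X) i x).
    rewrite mulmx_sum_row {1}(coord_vbasis xX); apply: eq_bigr => i _.
    by rewrite mxE rowK.
  rewrite mulmx_sum_row; apply: memv_suml => i _; rewrite rowK memvZ//.
  by apply: vbasis_mem; rewrite mem_nth// size_tuple.
rewrite (_ : [set x | _] = \bigcap_(j in [set: 'I_n.+1])
    [set x : V | dotp x ((col j (cokermx W))^T) = 0]); last first.
  apply/seteqP; split => x /=.
    rewrite memE => /eqP/rowP xW j _; have := xW j; rewrite mxE [RHS]mxE /= => E.
    by rewrite dotpE -[RHS]E; apply: eq_bigr => k _; rewrite !mxE.
  move=> xW; rewrite memE; apply/eqP/rowP => j; have := xW j I.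
  rewrite /= dotpE => E; rewrite [RHS]mxE -[RHS]E mxE.
  by apply: eq_bigr => k _; rewrite !mxE.
apply: closed_bigI => j _.
have /continuous_closedP/(_ [set 0]) := @continuous_dotp R _ (col j (cokermx W))^T.
by apply; exact: closed_eq.
Qed.

Lemma measurable_on_subspace (X : {vspace V}) :
  measurable (on_subspace X : set (borel_sphere R n)).
Proof. exact: (measurable_sphere_closed (closed_vspace (X := X))). Qed.

Lemma measurable_hemisphere (v : V) :
  measurable ([set x : sphere R n | 0 <= dotp (\val x) v] : set (borel_sphere R n)).
Proof.
apply: (@measurable_sphere_closed [set y | 0 <= dotp y v]).
have /continuous_closedP/(_ [set y | 0 <= y]) := @continuous_dotp R _ v.
by apply; exact: closed_ge.
Qed.

End sphere_sets.

(** Group the atoms that are equal and add up their masses. *)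
Lemma discrete_distinct (R : realType) (n : nat)
    (mu : {measure set (borel_sphere R n) -> \bar R}) : is_discrete mu ->
  exists (N : nat) (gam : 'I_N -> R) (U : 'I_N -> borel_sphere R n),
    [/\ injective U, (forall i, 0 < gam i) &
     forall A, measurable A -> mu A = (\sum_(i | U i \in A) gam i)%:E].
Proof.
move=> [N0 [gamma [w [gamma0 muE]]]].
pose s := undup (codom w).
pose U (i : 'I_(size s)) : borel_sphere R n := tnth (in_tuple s) i.
have U_inj : injective U by apply/tuple_uniqP; exact: undup_uniq.
have Uw j : exists i, U i = w j.
  have : w j \in in_tuple s by rewrite mem_undup codom_f.
  by move=> /tnthP[i ->]; exists i.
have wU i : exists j, U i = w j.
  have : U i \in s by exact: mem_tnth.
  by rewrite mem_undup => /codomP[j ->]; exists j.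
exists (size s), (fun i => \sum_(j | w j == U i) gamma j), U; split=> //.
  move=> i; have [j wj] := wU i; rewrite (bigD1 j) ?wj//= ltr_pwDl// sumr_ge0// => k _.
  exact: ltW.
move=> A mA; rewrite muE//.
transitivity (\sum_(j | w j \in A) gamma j)%:E.
  rewrite -sumEFin [RHS]big_mkcond; apply: eq_bigr => j _; rewrite diracE.
  by case: (_ \in _); rewrite ?mule1 ?mule0.
congr (_%:E); rewrite (exchange_big_dep (fun j => w j \in A)) /=; last first.
  by move=> i j UA /eqP ->.
apply: eq_bigr => j wA; have [i Ui] := Uw j.
rewrite (bigD1 i) ?Ui ?wA ?eqxx//= big1 ?addr0// => k /andP[/andP[_ /eqP wk] ki].
by case/eqP: ki; apply: U_inj; rewrite Ui.
Qed.

Theorem theorem1p5 (R : realType) (n : nat)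
    (mu : {measure set (borel_sphere R n) -> \bar R})
    (mu_discrete : is_discrete mu)
    (mu_not_concentrated : ~ exists2 H : set (sphere R n),
       is_closed_hemisphere fullv H & concentrated_on mu H)
    (mu_escc : essential_subspace_concentration mu) :
  exists P : set 'rV[R]_n.+1,
    [/\ is_polytope P, interior P 0 &
      forall A : set (borel_sphere R n), measurable A ->
        cone_volume_measure P A = mu A].
Proof.
have [N [gam [U [U_inj gam0 muE]]]] := discrete_distinct mu_discrete.
pose u i : 'rV[R]_n.+1 := \val (U i : sphere R n).
have u_inj : injective u by move=> i j /val_inj/U_inj.
have u1 i : dotp (u i) (u i) = 1 by exact: set_valP (U i : sphere R n).
have u0 i : u i != 0 by rewrite -dotp_eq0 u1 oner_eq0.
have span_pos v : v != 0 -> exists i, dotp (u i) v < 0.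
  move=> v0; apply: contrapT => nex; apply: mu_not_concentrated.
  exists (on_subspace fullv `&` [set x | 0 <= dotp (\val x) v]).
    by exists v; split=> //; exact: memvf.
  rewrite /concentrated_on muE; last first.
    apply: measurableC; apply: measurableI; first exact: measurable_on_subspace.
    exact: measurable_hemisphere.
  rewrite big1// => i; rewrite inE => -[]; split; first exact: memvf.
  by rewrite /= leNgt; apply/negP => lt; apply: nex; exists i.
have mu_subspace X : mu (on_subspace X) = (mass u gam X)%:E.
  rewrite muE; last exact: measurable_on_subspace.
  by congr (_%:E); apply: eq_bigl => i; apply/idP/idP; rewrite inE.
have muT : mu setT = (total_mass gam)%:E.
  rewrite muE//; congr (_%:E); by apply: eq_bigl => i; rewrite in_setT.
have conc : subspace_concentration u gam.
  move=> X dX sp.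
  have : essential_subspace mu X.
    split=> // -[H [v [vX v0 ->]] sub].
    have [i iX] := sp v vX v0; apply/negP; rewrite -leNgt.
    have : (on_subspace X `&` Defs.support mu) (U i).
      split=> // O oO OU; rewrite muE; last exact: sub_sigma_algebra.
      rewrite lte_fin (bigD1 i) ?mem_set//= ltr_pwDl// sumr_ge0// => j _; exact: ltW.
    by move=> /sub[].
  move=> /mu_escc; rewrite mu_subspace muT -EFinM lee_fin => -[le eqn]; split=> // E.
  have [|X' [XT X0] mX'] := eqn; first by rewrite E.
  exists X'; split=> //; apply: EFin_inj.
  by rewrite -mu_subspace mX'.
have T0 := total_mass_gt0 gam0 span_pos.
have one0 (i : 'I_N) : (0 : R) < 1 by [].
have [z z0 cz] := centering gam0 span_pos one0.
have [h1 [h10 ch1 min1]] := exists_minimiser gam0 u0 span_pos conc z0 cz.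
(* The scaling factor for which the volume of the polyhedron is the total mass. *)
pose c := expR ((ln (total_mass gam) - ln (polyhedron_vol u h1)) / n.+1%:R).
have c0 : 0 < c by exact: expR_gt0.
pose h i := c * h1 i.
have h0 i : 0 < h i by rewrite mulr_gt0.
have ch : critical u gam h by exact: critical_scale.
have hmin h' : (forall i, 0 < h' i) -> critical u gam h' -> energy u gam h <= energy u gam h'.
  by move=> h'0 ch'; rewrite (energy_scale gam span_pos c0 h10) min1.
have hV : polyhedron_vol u h = total_mass gam.
  have V0 := polyhedron_vol_gt0 span_pos h10.
  rewrite (polyhedron_vol_scale span_pos)// -expRM_natl mulrCA divff ?pnatr_eq0// mulr1.
  by rewrite expRD expRN !lnK ?posrE// divfK// gt_eqF.
pose P := polyhedron u h.
have facet i : exists x (M : 'M[R]_(n, n.+1)), [/\ P x, dotp x (u i) = h i, row_free M,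
     face P (u i) x & forall k, face P (u i) (x + row k M)].
  have [B hB] := orthonormal_basis_perp_ex (u1 i).
  apply: (constraint_is_facet_normal h0 u1 u_inj hB).
  rewrite (minimiser_facet_area gam0 span_pos u1 u_inj h0 ch hmin hB) lte_fin hV.
  by rewrite mulr_gt0// divr_gt0 ?mulr_gt0.
pose s := [seq U i | i <- enum 'I_N].
have us : uniq s by rewrite map_inj_uniq ?enum_uniq.
have normalsE : facet_normals P = [set` s].
  apply/seteqP; split => v.
    move=> [x [M [fM fx fM']]].
    have v1 : dotp (\val v) (\val v) = 1 by exact: set_valP v.
    have [i vi] := facet_normal_is_constraint span_pos h0 u1 v1 fM fx fM'.
    apply/mapP; exists i; rewrite ?mem_enum//; exact: val_inj.
  move=> /mapP[i _ ->]; have [x [M [_ _ fM fx fM']]] := facet i.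
  by exists x, M.
exists P; split.
- exact: polyhedron_is_polytope.
- exact: polyhedron_interior0.
move=> A mA; rewrite /cone_volume_measure normalsE -fsbig_seq// big_map big_enum /=.
rewrite muE// -sumEFin [RHS]big_mkcond; apply: eq_bigr => i _.
have [x [M [Px xi _ _ _]]] := facet i.
rewrite -/(u i) (facet_distanceE h0 u1 Px xi).
rewrite (hyperplane_measure_face u1 (support_touching Px xi)).
have hB := xgetPex 0 (orthonormal_basis_perp_ex (u1 i)).
rewrite (minimiser_facet_area gam0 span_pos u1 u_inj h0 ch hmin hB) hV.
rewrite diracE -!EFinM; case: (_ \in _); congr (_%:E); last by rewrite mulr0.
rewrite mulr1.
have : (n.+1%:R : R) != 0 by rewrite pnatr_eq0.
by move: (n.+1%:R : R) => d d0; field; rewrite d0 !gt_eqF.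
Qed.
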